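(* Let $k$ be a field of characteristic $p>0$ with $[k:k^p]<\infty$, let $S=k[x_0,\dots,x_n]$ with the standard grading, and let $\mathfrak{m}=(x_0,\dots,x_n)$. Let $J=(f_1,\dots,f_c)\subseteq S$ be an ideal generated by a homogeneous regular sequence $f_1,\dots,f_c$, put $R=S/J$ and $d=\sum_{j=1}^c\deg(f_j)$. Let $\mathrm{Jac}(R)\subseteq S$ be the ideal generated by the $c\times c$ minors of the Jacobian matrix $(\partial f_j/\partial x_i)$, $0\le i\le n$, $1\le j\le c$, and suppose $\sqrt{\mathrm{Jac}(R)+J}=\mathfrak{m}$. If $p\ge(n+1-c)(d-c)$, then the Frobenius action $$F: H^{n+1-c}_{\mathfrak{m}}(R)_{<0}\to H^{n+1-c}_{\mathfrak{m}}(R)_{<0}$$ is injective.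
   Context: For a graded module $M$, $M_{<t}$ denotes $\bigoplus_{s<t}M_s$. The elements of the homogeneous regular sequence are homogeneous forms of positive degree. $H^i_{\mathfrak{m}}(R)$ is the $\mathbb{Z}$-graded local cohomology of $R$ with support in $\mathfrak{m}$, and the Frobenius action $F$ on it is the additive map induced by the Frobenius homomorphism $r\mapsto r^p$ of $R$; it sends elements of degree $t$ to elements of degree $pt$. *)

(* Defs.v *)
From HB Require Import structures.
From mathcomp Require Import all_boot all_order all_algebra.
From mathcomp Require Import generic_quotient ring_quotient boolp.
From mathcomp Require Import mpoly ring.

Set Implicit Arguments.
Unset Strict Implicit.
Unset Printing Implicit Defensive.

Import Order.TTheory GRing.Theory Num.Theory.
Local Open Scope ring_scope.
Local Open Scope quotient_scope.

(* [p \in [pchar A]] without the requirement 1 != 0 on A, since quotients and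
   localizations may vanish. *)
Definition has_pchar (A : pzRingType) (p : nat) : Prop :=
  prime p /\ p%:R = 0 :> A.

Lemma pcharD_expr (A : comPzRingType) p (a b : A) :
  has_pchar A p -> (a + b) ^+ p = a ^+ p + b ^+ p.
Proof.
move=> [p_pr p0]; have := prime_gt0 p_pr.
case: p => // q in p_pr p0 * => _.
rewrite exprDn big_ord_recr big_ord_recl /= subnn subn0 mulr1 mul1r.
rewrite bin0 binn !mulr1n big1 ?addr0 // => i _.
have /dvdnP[t ->] : (q.+1 %| 'C(q.+1, bump 0 i))%N.
  by rewrite prime_dvd_bin // /bump /= add1n ltnS ltn_ord.
by rewrite mulrnA -mulr_natr p0 mulr0.
Qed.

Lemma pcharN_expr (A : comPzRingType) p (a : A) :
  has_pchar A p -> (- a) ^+ p = - a ^+ p.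
Proof.
move=> hp; apply/eqP; rewrite -addr_eq0 -pcharD_expr // addNr expr0n.
by case: hp => /prime_gt0; case: (p).
Qed.

Lemma pchar_expr_sign (A : comPzRingType) p n (a : A) :
  has_pchar A p -> ((-1) ^+ n * a) ^+ p = (-1) ^+ n * a ^+ p.
Proof.
by move=> hp; rewrite exprMn exprAC pcharN_expr // expr1n.
Qed.

Lemma pchar_expr_sum (A : comPzRingType) p (I : Type) (r : seq I) (P : pred I)
    (F : I -> A) : has_pchar A p ->
  (\sum_(i <- r | P i) F i) ^+ p = \sum_(i <- r | P i) F i ^+ p.
Proof.
move=> hp; elim/big_rec2: _ => [|i a b _ <-]; last by rewrite pcharD_expr.
by rewrite expr0n; case: hp => /prime_gt0; case: (p).
Qed.

Section Ideals.
Variable A : comPzRingType.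
Implicit Types (G I J : A -> Prop) (a b : A).

Definition ideal_gen G a : Prop :=
  exists2 s : seq (A * A), (forall u, u \in s -> G u.2) &
    a = \sum_(u <- s) u.1 * u.2.

Definition ideal_add I J a : Prop :=
  exists b c, [/\ I b, J c & a = b + c].

Definition ideal_radical I a : Prop := exists N : nat, I (a ^+ N).

Lemma ideal_gen0 G : ideal_gen G 0.
Proof. by exists [::]; rewrite ?big_nil. Qed.

Lemma ideal_genD G a b : ideal_gen G a -> ideal_gen G b -> ideal_gen G (a + b).
Proof.
move=> [s sG ->] [t tG ->]; exists (s ++ t); last by rewrite big_cat.
by move=> u; rewrite mem_cat => /orP[/sG|/tG].
Qed.

Lemma ideal_genM G a b : ideal_gen G b -> ideal_gen G (a * b).
Proof.
move=> [s sG ->]; exists [seq (a * u.1, u.2) | u <- s].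
  by move=> _ /mapP[u /sG Gu ->].
by rewrite big_map mulr_sumr; apply: eq_bigr => u _; rewrite mulrA.
Qed.

Lemma ideal_gen_mem G a : G a -> ideal_gen G a.
Proof.
move=> Ga; exists [:: (1, a)]; last by rewrite big_seq1 mul1r.
by move=> u; rewrite inE => /eqP->.
Qed.

(* The first condition of a regular sequence is that each f i is a nonzerodivisor
   modulo its predecessors, the second that the f i generate a proper ideal. *)
Definition regular_sequence (c : nat) (f : 'I_c -> A) : Prop :=
  (forall (i : 'I_c) a,
     ideal_gen (fun g => exists2 j : 'I_c, (j < i)%N & g = f j) (f i * a) ->
     ideal_gen (fun g => exists2 j : 'I_c, (j < i)%N & g = f j) a)
  /\ ~ ideal_gen (fun g => exists j : 'I_c, g = f j) 1.

End Ideals.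

(* [idealr] of ring_quotient only covers proper ideals; here the ideal generated
   by G is arbitrary, so the ring structure is put on [Quotient.quot] directly. *)
Section IdealQuotient.
Variables (A : comPzRingType) (G : A -> Prop).

Definition ideal_pred (a : A) : bool := `[< ideal_gen G a >].

Fact ideal_pred_zmod_closed : zmod_closed ideal_pred.
Proof.
split=> [|a b]; first by apply/asboolP/ideal_gen0.
move=> /asboolP Ga /asboolP Gb; apply/asboolP/ideal_genD => //.
by rewrite -mulN1r; apply: ideal_genM.
Qed.
HB.instance Definition _ :=
  GRing.isZmodClosed.Build A ideal_pred ideal_pred_zmod_closed.
Definition ideal_zmod : zmodClosed A := GRing.ZmodClosed.clone _ ideal_pred _.

Definition quo : Type := Quotient.quot ideal_zmod.
HB.instance Definition _ := GRing.Zmodule.on quo.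

Definition to_quo (a : A) : quo := \pi_(Quotient.quot ideal_zmod) a.

Lemma to_quoE a b : to_quo a = to_quo b <-> ideal_gen G (a - b).
Proof.
split=> [/eqP|h]; first by rewrite -Quotient.idealrBE => /asboolP.
by apply/eqP; rewrite -Quotient.idealrBE; apply/asboolP.
Qed.

Lemma to_quo_surj (r : quo) : exists a, r = to_quo a.
Proof. by exists (repr r); rewrite /to_quo reprK. Qed.

Fact to_quo_zmod_morphism : zmod_morphism to_quo.
Proof. exact: (raddfB \pi_(Quotient.quot ideal_zmod)). Qed.
HB.instance Definition _ :=
  GRing.isZmodMorphism.Build A quo to_quo to_quo_zmod_morphism.

Definition quo_mul (r s : quo) : quo := to_quo (repr r * repr s).

Lemma quo_mulE a b : quo_mul (to_quo a) (to_quo b) = to_quo (a * b).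
Proof.
have reprP c : ideal_gen G (repr (to_quo c) - c).
  by apply/to_quoE; rewrite /to_quo reprK.
apply/to_quoE; set a' := repr _; set b' := repr _.
rewrite -[a' * _](subrK (a' * b)) -mulrBr -addrA -mulrBl.
by apply: ideal_genD; [|rewrite mulrC]; apply: ideal_genM; apply: reprP.
Qed.

Fact quo_mulA : associative quo_mul.
Proof.
move=> r s t; have [a ->] := to_quo_surj r; have [b ->] := to_quo_surj s.
by have [c ->] := to_quo_surj t; rewrite !quo_mulE mulrA.
Qed.
Fact quo_mulC : commutative quo_mul.
Proof. by move=> r s; rewrite /quo_mul mulrC. Qed.
Fact quo_mul1 : left_id (to_quo 1) quo_mul.
Proof. by move=> r; have [a ->] := to_quo_surj r; rewrite quo_mulE mul1r. Qed.
Fact quo_mulD : left_distributive quo_mul +%R.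
Proof.
move=> r s t; have [a ->] := to_quo_surj r; have [b ->] := to_quo_surj s.
by have [c ->] := to_quo_surj t; rewrite -raddfD !quo_mulE mulrDl raddfD.
Qed.
HB.instance Definition _ :=
  GRing.Zmodule_isComPzRing.Build quo quo_mulA quo_mulC quo_mul1 quo_mulD.

Fact to_quo_monoid_morphism : monoid_morphism to_quo.
Proof. by split=> // a b; rewrite -quo_mulE. Qed.
HB.instance Definition _ :=
  GRing.isMonoidMorphism.Build A quo to_quo to_quo_monoid_morphism.

Lemma quo_pchar p : has_pchar A p -> has_pchar quo p.
Proof. by case=> p_pr p0; split=> //; rewrite -(rmorph_nat to_quo) p0 rmorph0. Qed.

End IdealQuotient.

(* The localization A[1/u]; the pair (a, e) stands for the fraction a / u ^+ e. *)
Section Localization.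
Variables (A : comPzRingType) (u : A).


Definition loc_equiv : rel (A * nat) := fun x y : A * nat =>
  `[< exists N, u ^+ N * (x.1 * u ^+ y.2) = u ^+ N * (y.1 * u ^+ x.2) >].

Fact loc_equiv_is_equiv : equiv_class_of loc_equiv.
Proof.
split=> [x|x y|y x z].
- by apply/asboolP; exists 0.
- by apply/asboolP/asboolP => -[N h]; exists N.
- move=> /asboolP[N h] /asboolP[M k]; apply/asboolP; exists (N + M + y.2)%N.
  have -> : u ^+ (N + M + y.2) * (x.1 * u ^+ z.2) =
            u ^+ M * u ^+ z.2 * (u ^+ N * (x.1 * u ^+ y.2)).
    by rewrite !exprD; ring.
  rewrite h.
  have -> : u ^+ M * u ^+ z.2 * (u ^+ N * (y.1 * u ^+ x.2)) =
            u ^+ N * u ^+ x.2 * (u ^+ M * (y.1 * u ^+ z.2)) by ring.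
  by rewrite k !exprD; ring.
Qed.
Canonical loc_equiv_rel := EquivRelPack loc_equiv_is_equiv.
Canonical loc_encModRel := defaultEncModRel loc_equiv.

Definition loc : Type := {eq_quot loc_equiv}.
HB.instance Definition _ := Choice.on loc.

Definition frac (a : A) (e : nat) : loc := \pi_({eq_quot loc_equiv}) (a, e).

Lemma fracE a d b e : frac a d = frac b e <->
  exists N, u ^+ N * (a * u ^+ e) = u ^+ N * (b * u ^+ d).
Proof.
split=> [/eqP|h]; first by rewrite /frac piE => /asboolP.
by apply/eqP; rewrite /frac piE; apply/asboolP.
Qed.

Definition num (z : loc) : A := (repr z).1.
Definition den (z : loc) : nat := (repr z).2.

Lemma frac_num_den z : frac (num z) (den z) = z.
Proof. by rewrite /frac /num /den -surjective_pairing reprK. Qed.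

Lemma frac_surj (z : loc) : exists a e, z = frac a e.
Proof. by exists (num z), (den z); rewrite frac_num_den. Qed.

Lemma num_den_frac a e : exists N,
  u ^+ N * (num (frac a e) * u ^+ e) = u ^+ N * (a * u ^+ den (frac a e)).
Proof. by apply/fracE; rewrite frac_num_den. Qed.

Definition loc_add (y z : loc) : loc :=
  frac (num y * u ^+ den z + num z * u ^+ den y) (den y + den z).
Definition loc_opp (z : loc) : loc := frac (- num z) (den z).
Definition loc_mul (y z : loc) : loc := frac (num y * num z) (den y + den z).

Lemma loc_addE a d b e :
  loc_add (frac a d) (frac b e) = frac (a * u ^+ e + b * u ^+ d) (d + e).
Proof.
have [N] := num_den_frac a d; have [M] := num_den_frac b e.
rewrite /loc_add; move: (num _) (den _) (num _) (den _) => a' d' b' e' hb ha.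
apply/fracE; exists (N + M)%N; rewrite !exprD.
transitivity (u ^+ M * u ^+ e * u ^+ e' * (u ^+ N * (a' * u ^+ d)) +
              u ^+ N * u ^+ d * u ^+ d' * (u ^+ M * (b' * u ^+ e))); first by ring.
by rewrite ha hb; ring.
Qed.

Lemma loc_oppE a e : loc_opp (frac a e) = frac (- a) e.
Proof.
have [N h] := num_den_frac a e.
by apply/fracE; exists N; rewrite !mulNr !mulrN h.
Qed.

Lemma loc_mulE a d b e :
  loc_mul (frac a d) (frac b e) = frac (a * b) (d + e).
Proof.
have [N] := num_den_frac a d; have [M] := num_den_frac b e.
rewrite /loc_mul; move: (num _) (den _) (num _) (den _) => a' d' b' e' hb ha.
apply/fracE; exists (N + M)%N; rewrite !exprD.
transitivity ((u ^+ N * (a' * u ^+ d)) * (u ^+ M * (b' * u ^+ e))); first by ring.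
by rewrite ha hb; ring.
Qed.

Lemma locW (P : loc -> Prop) : (forall a e, P (frac a e)) -> forall z, P z.
Proof. by move=> h z; have [a [e ->]] := frac_surj z. Qed.

Fact loc_addA : associative loc_add.
Proof.
move=> x y z; elim/locW: x => a d; elim/locW: y => b e; elim/locW: z => c g.
rewrite !loc_addE addnA; congr frac; rewrite !exprD; ring.
Qed.
Fact loc_addC : commutative loc_add.
Proof.
move=> x y; elim/locW: x => a d; elim/locW: y => b e.
by rewrite !loc_addE addnC addrC.
Qed.
Fact loc_add0 : left_id (frac 0 0) loc_add.
Proof.
move=> x; elim/locW: x => a d.
by rewrite loc_addE mul0r add0r expr0 mulr1.
Qed.
Fact loc_addN : left_inverse (frac 0 0) loc_opp loc_add.
Proof.
move=> x; elim/locW: x => a d.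
rewrite loc_oppE loc_addE; apply/fracE; exists 0%N.
by rewrite mulNr addNr !mul0r.
Qed.
HB.instance Definition _ :=
  GRing.isZmodule.Build loc loc_addA loc_addC loc_add0 loc_addN.

Fact loc_mulA : associative loc_mul.
Proof.
move=> x y z; elim/locW: x => a d; elim/locW: y => b e; elim/locW: z => c g.
by rewrite !loc_mulE addnA mulrA.
Qed.
Fact loc_mulC : commutative loc_mul.
Proof.
move=> x y; elim/locW: x => a d; elim/locW: y => b e.
by rewrite !loc_mulE addnC mulrC.
Qed.
Fact loc_mul1 : left_id (frac 1 0) loc_mul.
Proof.
move=> x; elim/locW: x => a d.
by rewrite loc_mulE mul1r.
Qed.
Fact loc_mulD : left_distributive loc_mul +%R.
Proof.
move=> x y z; elim/locW: x => a d; elim/locW: y => b e; elim/locW: z => c g.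
rewrite /+%R /= loc_addE !loc_mulE loc_addE; apply/fracE; exists 0%N.
by rewrite !exprD; ring.
Qed.
HB.instance Definition _ :=
  GRing.Zmodule_isComPzRing.Build loc loc_mulA loc_mulC loc_mul1 loc_mulD.

Lemma fracD a d b e :
  frac a d + frac b e = frac (a * u ^+ e + b * u ^+ d) (d + e).
Proof. exact: loc_addE. Qed.

Lemma fracN a e : - frac a e = frac (- a) e.
Proof. exact: loc_oppE. Qed.

Lemma fracM a d b e : frac a d * frac b e = frac (a * b) (d + e).
Proof. exact: loc_mulE. Qed.

Lemma fracX a e n : frac a e ^+ n = frac (a ^+ n) (e * n).
Proof.
elim: n => [|n IHn]; first by rewrite !expr0 muln0.
by rewrite !exprS IHn fracM mulnS.
Qed.

Lemma frac_eq0 a e : frac a e = 0 <-> exists N, u ^+ N * a = 0.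
Proof.
split=> [/fracE[N]|[N h]]; first by rewrite expr0 mulr1 mul0r mulr0; exists N.
by apply/fracE; exists N; rewrite expr0 mulr1 mul0r mulr0.
Qed.

Fact frac0_zmod_morphism : zmod_morphism (frac^~ 0%N).
Proof. by move=> a b; rewrite fracN fracD expr0 !mulr1. Qed.
Fact frac0_monoid_morphism : monoid_morphism (frac^~ 0%N).
Proof. by split=> // a b; rewrite fracM. Qed.

Lemma loc_pchar p : has_pchar A p -> has_pchar loc p.
Proof.
move=> [p_pr p0]; split=> //.
have h n : n%:R = frac n%:R 0.
  by elim: n => // n IHn; rewrite !mulrS IHn fracD expr0 !mulr1.
by rewrite h p0.
Qed.

End Localization.

(* The canonical map A[1/u] -> A[1/(v * u)], in the form needed when the target
   is A[1/w] for some w that is equal, not convertible, to v * u. *)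
Section LocalizationMap.
Variables (A : comPzRingType) (u v w : A).

Definition loc_map (z : loc u) : loc w := frac w (num z * v ^+ den z) (den z).

Hypothesis wE : w = v * u.

Lemma loc_mapE a e : loc_map (frac u a e) = frac w (a * v ^+ e) e.
Proof.
have [N h] := num_den_frac u a e.
rewrite /loc_map; move: (num _) (den _) h => a' e' h.
apply/fracE; exists N; rewrite wE !exprMn.
transitivity (v ^+ N * v ^+ e' * v ^+ e * (u ^+ N * (a' * u ^+ e))); first by ring.
by rewrite h; ring.
Qed.

Lemma loc_map_zmod_morphism : zmod_morphism loc_map.
Proof.
move=> x y; elim/locW: x => a d; elim/locW: y => b e.
rewrite fracN fracD !loc_mapE fracN fracD wE !exprMn; congr frac.
by rewrite exprD; ring.
Qed.

Lemma loc_mapN z : loc_map (- z) = - loc_map z.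
Proof. by elim/locW: z => a e; rewrite fracN !loc_mapE fracN mulNr. Qed.

Lemma loc_map_sign n z : loc_map ((-1) ^+ n * z) = (-1) ^+ n * loc_map z.
Proof.
elim: n => [|n IHn]; first by rewrite !mul1r.
by rewrite !exprS !mulN1r !mulNr loc_mapN IHn.
Qed.

Lemma loc_map_sum (J : Type) (r : seq J) (P : pred J) (F : J -> loc u) :
  loc_map (\sum_(i <- r | P i) F i) = \sum_(i <- r | P i) loc_map (F i).
Proof.
elim/big_rec2: _ => [|i a b _ <-].
  by rewrite -{1}(subrr 0) loc_map_zmod_morphism subrr.
by rewrite -[b in LHS]opprK loc_map_zmod_morphism loc_mapN opprK.
Qed.

Lemma loc_map_monoid_morphism : monoid_morphism loc_map.
Proof.
split=> [|x y]; first by rewrite [LHS]loc_mapE mul1r.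
elim/locW: x => a d; elim/locW: y => b e.
by rewrite fracM !loc_mapE fracM exprD; congr frac; ring.
Qed.

End LocalizationMap.

(* The Cech complex of A with respect to x_0, ..., x_(m-1) is
     C^i = \bigoplus_(#|I| = i) A[1/x_I],   x_I = \prod_(l in I) x_l.
   [cech] is the total module \bigoplus_i C^i and [cech_diff] the total
   differential; C^i is the set of families supported on subsets of size i. *)
Section CechComplex.
Variables (A : comPzRingType) (m : nat) (x : 'I_m -> A).

Definition cprod (I : {set 'I_m}) : A := \prod_(l in I) x l.

Lemma cprodD1 (I : {set 'I_m}) j : j \in I -> cprod I = x j * cprod (I :\ j).
Proof. exact: big_setD1. Qed.

Definition cech : Type := {dffun forall I : {set 'I_m}, loc (cprod I)}.
HB.instance Definition _ := Choice.on cech.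

Definition mkcech (F : forall I : {set 'I_m}, loc (cprod I)) : cech := finfun F.
Definition cech_coord (I : {set 'I_m}) (z : cech) : loc (cprod I) := z I.

Lemma cech_coordE F I : cech_coord I (mkcech F) = F I.
Proof. exact: ffunE. Qed.

Lemma cechP (y z : cech) : (forall I, cech_coord I y = cech_coord I z) -> y = z.
Proof. by move=> h; apply/ffunP => I; apply: h. Qed.

Definition cech_add (y z : cech) := mkcech (fun I => cech_coord I y + cech_coord I z).
Definition cech_opp (z : cech) := mkcech (fun I => - cech_coord I z).
Definition cech_zero := mkcech (fun I => 0).

Fact cech_addA : associative cech_add.
Proof. by move=> *; apply: cechP => I; rewrite !cech_coordE addrA. Qed.
Fact cech_addC : commutative cech_add.
Proof. by move=> *; apply: cechP => I; rewrite !cech_coordE addrC. Qed.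
Fact cech_add0 : left_id cech_zero cech_add.
Proof. by move=> *; apply: cechP => I; rewrite !cech_coordE add0r. Qed.
Fact cech_addN : left_inverse cech_zero cech_opp cech_add.
Proof. by move=> *; apply: cechP => I; rewrite !cech_coordE addNr. Qed.
HB.instance Definition _ :=
  GRing.isZmodule.Build cech cech_addA cech_addC cech_add0 cech_addN.

Fact cech_coord_zmod_morphism I : zmod_morphism (cech_coord I).
Proof.
move=> y z; rewrite {1}/+%R /= /cech_add cech_coordE; congr (_ + _).
by rewrite {1}/-%R /= cech_coordE.
Qed.
HB.instance Definition _ I := GRing.isZmodMorphism.Build cech (loc (cprod I))
  (cech_coord I) (cech_coord_zmod_morphism I).

Definition cech_diff (z : cech) : cech :=
  mkcech (fun I => \sum_(j in I) (-1) ^+ #|[set l in I | (l < j)%N]| *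
    loc_map (x j) (cprod I) (cech_coord (I :\ j) z)).

Fact cech_diff_zmod_morphism : zmod_morphism cech_diff.
Proof.
move=> y z; apply: cechP => I; rewrite [RHS]raddfB /= !cech_coordE -sumrB.
apply: eq_bigr => j jI; rewrite raddfB -mulrBr.
by rewrite loc_map_zmod_morphism //; apply: cprodD1.
Qed.
HB.instance Definition _ :=
  GRing.isZmodMorphism.Build cech cech cech_diff cech_diff_zmod_morphism.

Lemma cech_diffK (z : cech) : cech_diff (cech_diff z) = 0.
Proof.
apply: cechP => I; rewrite raddf0 cech_coordE.
pose N (j : 'I_m) := #|[set l in I | (l < j)%N]|.
pose h j l := loc_map (x j * x l) (cprod I) (cech_coord (I :\ j :\ l) z).
have hC (j l : 'I_m) : h j l = h l j.
  by rewrite /h mulrC; have -> : I :\ j :\ l = I :\ l :\ j by rewrite !setDDl setUC.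
have hE (j l : 'I_m) : j \in I -> l \in I -> l != j ->
    loc_map (x j) (cprod I) (loc_map (x l) (cprod (I :\ j))
      (cech_coord (I :\ j :\ l) z)) = h j l.
  move=> jI lI lj; have lIj : l \in I :\ j by rewrite !inE lj.
  rewrite /h; elim/locW: (cech_coord _ z) => a e.
  rewrite (loc_mapE (cprodD1 lIj)) (loc_mapE (cprodD1 jI)).
  rewrite (@loc_mapE _ _ (x j * x l)); last by rewrite -mulrA -(cprodD1 lIj) -cprodD1.
  by rewrite exprMn; congr frac; ring.
have NE (j l : 'I_m) : l \in I -> l != j -> (j < l)%N ->
    N l = #|[set i in I :\ j | (i < l)%N]|.+1 \/ j \notin I.
  move=> lI lj jl; case: (boolP (j \in I)) => jI; [left|by right].
  rewrite /N (cardsD1 j) !inE jI jl; congr _.+1; apply: eq_card => i.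
  by rewrite !inE andbA.
have NE' (j l : 'I_m) : l \in I -> (l < j)%N -> N l = #|[set i in I :\ j | (i < l)%N]|.
  move=> lI lj; apply: eq_card => i; rewrite !inE.
  by case: (i =P j) => //= ->; rewrite [(j < l)%N]ltnNge ltnW // andbF.
transitivity (\sum_(j in I) \sum_(l in I | (l < j)%N)
                 (-1) ^+ N j * (-1) ^+ N l * h j l +
              \sum_(j in I) \sum_(l in I | (j < l)%N)
                 - ((-1) ^+ N j * (-1) ^+ N l * h j l)).
  rewrite -big_split; apply: eq_bigr => j jI /=.
  rewrite cech_coordE.
  rewrite (loc_map_sum (cprodD1 jI)) mulr_sumr.
  rewrite (bigID (fun l : 'I_m => (l < j)%N)) /=; congr (_ + _).
    apply: eq_big => [l|l /andP[]]; rewrite !inE.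
      by case: (l =P j) => [->|_] //=; rewrite ltnn andbF.
    move=> /andP[lj lI] ltlj; rewrite (loc_map_sign (cprodD1 jI)).
    by rewrite -(NE' j l lI ltlj) hE // mulrA.
  apply: eq_big => [l|l /andP[]]; rewrite !inE.
    by rewrite -leqNgt ltn_neqAle; case: (l =P j) => [->|/eqP lj];
       rewrite ?eqxx ?andbF //= eq_sym -[(l == j :> nat)]/(l == j) lj.
  move=> /andP[lj lI]; rewrite -leqNgt => lejl.
  have ltjl : (j < l)%N by rewrite ltn_neqAle lejl eq_sym lj.
  have [->|] := NE j l lI lj ltjl; last by rewrite jI.
  rewrite (loc_map_sign (cprodD1 jI)) hE //.
  by rewrite exprS mulN1r mulrN mulNr opprK mulrA.
rewrite [X in _ + X](exchange_big_dep (mem I)) /=; last by move=> ? ? _ /andP[].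
rewrite -big_split big1 //= => j jI.
have -> : \sum_(i in I | (j \in I) && (i < j)%N) - ((-1) ^+ N i * (-1) ^+ N j * h i j) =
          - \sum_(l in I | (l < j)%N) (-1) ^+ N j * (-1) ^+ N l * h j l.
  rewrite -sumrN; apply: eq_big => l; first by rewrite jI.
  by move=> _; rewrite hC [(-1) ^+ N l * _]mulrC.
by rewrite subrr.
Qed.

Definition cech_degree (i : nat) (z : cech) : Prop :=
  forall I : {set 'I_m}, #|I| <> i -> cech_coord I z = 0.

(* H^i = Z^i / B^i, where Z^i is the group of i-cocycles and B^i the image of
   C^(i-1), read as 0 when i = 0. *)
Definition cocycle_pred (i : nat) (z : cech) : bool :=
  `[< cech_degree i z /\ cech_diff z = 0 >].

Fact cocycle_zmod_closed i : zmod_closed (cocycle_pred i).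
Proof.
split=> [|y z].
  by apply/asboolP; split; rewrite ?raddf0 // => I _; rewrite raddf0.
move=> /asboolP[yi dy] /asboolP[zi dz]; apply/asboolP; split.
  by move=> I Ii; rewrite raddfB /= yi // zi // subr0.
by rewrite raddfB /= dy dz subr0.
Qed.
HB.instance Definition _ i :=
  GRing.isZmodClosed.Build cech (cocycle_pred i) (cocycle_zmod_closed i).

Record cocycle (i : nat) :=
  Cocycle { cocycle_val :> cech; cocycleP : cocycle_val \in cocycle_pred i }.
HB.instance Definition _ i := [isSub for @cocycle_val i].
HB.instance Definition _ i := [Choice of cocycle i by <:].
HB.instance Definition _ i := [SubChoice_isSubZmodule of cocycle i by <:].

Definition coboundary_pred (i : nat) (z : cocycle i) : bool :=
  `[< exists w : cech, (forall I : {set 'I_m}, #|I|.+1 <> i -> cech_coord I w = 0)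
                    /\ cocycle_val z = cech_diff w >].

Fact coboundary_zmod_closed i : zmod_closed (@coboundary_pred i).
Proof.
split=> [|y z].
  by apply/asboolP; exists 0; split=> [I _|]; rewrite ?raddf0.
move=> /asboolP[v [vi yE]] /asboolP[w [wi zE]]; apply/asboolP; exists (v - w).
split=> [I Ii|]; first by rewrite raddfB /= vi // wi // subr0.
by rewrite raddfB /= -yE -zE.
Qed.
HB.instance Definition _ i :=
  GRing.isZmodClosed.Build (cocycle i) (@coboundary_pred i) (coboundary_zmod_closed i).
Definition coboundaries i : zmodClosed (cocycle i) :=
  GRing.ZmodClosed.clone _ (@coboundary_pred i) _.

Definition cech_coho (i : nat) : Type := Quotient.quot (coboundaries i).
HB.instance Definition _ i := GRing.Zmodule.on (cech_coho i).

Definition coho_class (i : nat) (z : cocycle i) : cech_coho i :=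
  \pi_(Quotient.quot (coboundaries i)) z.

Fact coho_class_zmod_morphism i : zmod_morphism (@coho_class i).
Proof. exact: (raddfB \pi_(Quotient.quot (coboundaries i))). Qed.

HB.instance Definition _ i := GRing.isZmodMorphism.Build (cocycle i) (cech_coho i)
  (@coho_class i) (@coho_class_zmod_morphism i).

Lemma coho_classE i (y z : cocycle i) :
  coho_class y = coho_class z <-> coboundary_pred (y - z).
Proof.
split=> [/eqP|h]; first by rewrite -Quotient.idealrBE.
by apply/eqP; rewrite -Quotient.idealrBE.
Qed.

Lemma coho_class_surj i (h : cech_coho i) : exists z, h = coho_class z.
Proof. by exists (repr h); rewrite /coho_class reprK. Qed.

Section Frobenius.
Variables (p : nat) (pA : has_pchar A p).

(* r |-> r ^+ p on each localization A[1/x_I]; see [cech_frob_diff]. *)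
Definition cech_frob (z : cech) : cech := mkcech (fun I => cech_coord I z ^+ p).

Lemma cech_frob_zmod_morphism : zmod_morphism cech_frob.
Proof.
move=> y z; apply: cechP => I.
rewrite [LHS]cech_coordE [RHS]raddfB [in LHS]raddfB /= !cech_coordE.
by have pL := loc_pchar (cprod I) pA; rewrite pcharD_expr // pcharN_expr.
Qed.
HB.instance Definition _ :=
  GRing.isZmodMorphism.Build cech cech cech_frob cech_frob_zmod_morphism.

Lemma cech_frob_diff z : cech_frob (cech_diff z) = cech_diff (cech_frob z).
Proof.
apply: cechP => I; rewrite !cech_coordE.
have pL := loc_pchar (cprod I) pA; rewrite pchar_expr_sum //.
apply: eq_bigr => j jI; rewrite pchar_expr_sign //; congr (_ * _).
rewrite cech_coordE; elim/locW: (cech_coord _ z) => a e.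
by rewrite fracX !(loc_mapE (cprodD1 jI)) fracX exprMn exprM.
Qed.

Lemma cech_frob_coord0 I z : cech_coord I z = 0 -> cech_coord I (cech_frob z) = 0.
Proof.
move=> z0; rewrite cech_coordE z0 expr0n.
by case: pA => /prime_gt0; case: (p).
Qed.

Fact cocycle_frobP i (z : cocycle i) : cech_frob z \in cocycle_pred i.
Proof.
have /asboolP[zi dz] := cocycleP z; apply/asboolP; split.
  by move=> I Ii; apply/cech_frob_coord0/zi.
by rewrite -cech_frob_diff dz raddf0.
Qed.
Definition cocycle_frob i (z : cocycle i) : cocycle i := Cocycle (cocycle_frobP z).

(* Independent of the representative chosen by [repr]: see [coho_frobE]. *)
Definition coho_frob i (h : cech_coho i) : cech_coho i :=
  coho_class (cocycle_frob (repr h)).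

Lemma coho_frobE i (z : cocycle i) :
  coho_frob (coho_class z) = coho_class (cocycle_frob z).
Proof.
rewrite /coho_frob; set y := repr _.
have /coho_classE/asboolP[w [wi yE]] : coho_class y = coho_class z.
  by rewrite /coho_class reprK.
apply/coho_classE/asboolP; exists (cech_frob w); split.
  by move=> I Ii; apply/cech_frob_coord0/wi.
by rewrite -cech_frob_diff -yE [RHS]raddfB.
Qed.

Lemma coho_frob_zmod_morphism i : zmod_morphism (@coho_frob i).
Proof.
move=> g h; have [y ->] := coho_class_surj g; have [z ->] := coho_class_surj h.
rewrite -raddfB !coho_frobE -raddfB; congr coho_class.
by apply: val_inj; rewrite [LHS]raddfB.
Qed.
HB.instance Definition _ i := GRing.isZmodMorphism.Build (cech_coho i) (cech_coho i)
  (@coho_frob i) (@coho_frob_zmod_morphism i).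

End Frobenius.

(* [gr s] is the degree s piece of A, and each x_l is meant to have degree 1, so
   that a / x_I ^+ e has degree s - e * #|I| for a of degree s.  The case r = 0 is
   needed separately: with s : nat, no such representation of 0 exists when I is
   empty and t < 0. *)
Section Grading.
Variable gr : nat -> A -> Prop.

Definition loc_homog (I : {set 'I_m}) (t : int) (r : loc (cprod I)) : Prop :=
  r = 0 \/ exists s a e,
    [/\ gr s a, r = frac (cprod I) a e & t = s%:Z - (e * #|I|)%:Z].

Definition cech_homog (t : int) (z : cech) : Prop :=
  forall I : {set 'I_m}, loc_homog t (cech_coord I z).

Definition coho_homog i (t : int) (h : cech_coho i) : Prop :=
  exists2 z : cocycle i, cech_homog t z & h = coho_class z.

(* The subgroup \bigoplus_(t < b) (H^i)_t. *)
Definition coho_lt i (b : int) (h : cech_coho i) : Prop :=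
  exists2 s : seq (cech_coho i),
    (forall g, g \in s -> exists2 t : int, t < b & coho_homog t g) &
    h = \sum_(g <- s) g.

Lemma coho_frob_homog p (pA : has_pchar A p) i t (h : cech_coho i) :
  (forall s a, gr s a -> gr (s * p) (a ^+ p)) ->
  coho_homog t h -> coho_homog (p%:Z * t) (coho_frob pA h).
Proof.
move=> grX [z tz ->]; exists (cocycle_frob pA z); last exact: coho_frobE.
move=> I; have [z0|[s [a [e [sa zE tE]]]]] := tz I.
  by left; apply: cech_frob_coord0.
right; exists (s * p)%N, (a ^+ p), (e * p)%N; split; first exact: grX.
  by rewrite cech_coordE zE fracX.
by rewrite tE !PoszM; ring.
Qed.

Lemma coho_frob_lt0 p (pA : has_pchar A p) i (h : cech_coho i) :
  (forall s a, gr s a -> gr (s * p) (a ^+ p)) ->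
  coho_lt 0 h -> coho_lt 0 (coho_frob pA h).
Proof.
move=> grX [s sP ->]; exists [seq coho_frob pA g | g <- s]; last first.
  by rewrite raddf_sum big_map.
move=> _ /mapP[g /sP[t t0 gt] ->]; exists (p%:Z * t); last exact: coho_frob_homog.
by rewrite pmulr_rlt0 //; case: pA => /prime_gt0.
Qed.

End Grading.

End CechComplex.

Section CompleteIntersection.
Variables (k : fieldType) (n c : nat).
Local Notation S := {mpoly k[n.+1]}.
Implicit Type f : 'I_c -> S.

Lemma mpoly_pchar p : p \in [pchar k] -> has_pchar S p.
Proof.
by move=> /andP[p_pr /eqP p0]; split=> //; rewrite -mpolyC_nat p0 mpolyC0.
Qed.

(* [k : k^p] is finite: k is spanned over k^p by finitely many elements. *)
Definition finite_over_pth_powers (p : nat) : Prop :=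
  exists s : seq k, forall a : k, exists b : 'I_(size s) -> k,
    a = \sum_(i < size s) b i ^+ p * s`_i.

Definition irrelevant_ideal : S -> Prop :=
  ideal_gen (fun g : S => exists i : 'I_n.+1, g = 'X_i).

Definition range_of f : S -> Prop := fun g => exists j : 'I_c, g = f j.

Definition jacobian_mx f : 'M[S]_(n.+1, c) := \matrix_(i, j) mderiv i (f j).

(* The maximal minors are indexed by the increasing selections of c rows. *)
Definition jacobian_ideal f : S -> Prop :=
  ideal_gen (fun g : S => exists r : 'I_c -> 'I_n.+1,
    (forall a b : 'I_c, (a < b)%N -> (r a < r b)%N) /\
    g = \det (rowsub r (jacobian_mx f))).

Local Notation ci_ring f := (quo (range_of f)).

Definition ci_var f (i : 'I_n.+1) : ci_ring f := to_quo (range_of f) 'X_i.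

Definition ci_degree f (t : nat) (r : ci_ring f) : Prop :=
  exists2 g : S, g \is t.-homog & r = to_quo (range_of f) g.

Lemma ci_degreeX f p t r : @ci_degree f t r -> ci_degree (t * p) (r ^+ p).
Proof.
move=> [g gt ->]; exists (g ^+ p); last by rewrite rmorphXn.
exact: dhomogMn.
Qed.

(* H^i_m(R), R = S/(f), is computed by the Cech complex of R on the images of the
   variables, which generate the ideal m R. *)
Definition local_coho f (i : nat) : Type := cech_coho (ci_var f) i.

Definition local_coho_lt f (i : nat) (b : int) : local_coho f i -> Prop :=
  coho_lt (@ci_degree f) b.

Definition local_coho_frob f (i : nat) (p : nat) (kp : p \in [pchar k]) :
    local_coho f i -> local_coho f i :=
  fun h => coho_frob (quo_pchar (range_of f) (mpoly_pchar kp)) h.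

Lemma local_coho_frob_lt0 f i p (kp : p \in [pchar k]) (h : local_coho f i) :
  local_coho_lt 0 h -> local_coho_lt 0 (local_coho_frob kp h).
Proof. by apply: coho_frob_lt0 => s a; apply: ci_degreeX. Qed.

End CompleteIntersection.

(* Main.v *)
Require Import Defs.
From HB Require Import structures.
From mathcomp Require Import all_boot all_order all_algebra.
From mathcomp Require Import perm boolp mpoly ring zify.

Set Implicit Arguments.
Unset Strict Implicit.
Unset Printing Implicit Defensive.

Import Defs GRing.Theory.
Local Open Scope ring_scope.

(** Let N = n + 1, D = N - c = dim R, d the sum of the degrees of the f_j, J the
    ideal they generate, and delta = d - c, which is the degree of the maximal minors of
    the Jacobian matrix.

    The top local cohomology of the polynomial ring S is transparent: it is the union of
    the quotients S / (x_0^e, ..., x_n^e), an element u standing for the fraction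
    u / (x_0 ... x_n)^e. As f_1, ..., f_c is a regular sequence, iterated connecting
    homomorphisms embed H^D(R) into it, onto the annihilator of J ([residue],
    [residue_eq0], [residue_lift]), and lower degrees by d. They turn the Frobenius of R
    into (f_1 ... f_c)^(p-1) times the Frobenius of S ([residue_frob]). A class of
    negative degree on which F vanishes thus becomes a polynomial eta, annihilated by J,
    with (f_1 ... f_c)^(p-1) eta^p = 0. (If c >= N, there is nothing to prove: H^0 lives
    in nonnegative degrees.)

    Partial derivatives act on the top local cohomology of S and kill p-th powers.
    Differentiating f^(b + 1_j) eta^p = 0 for some j with b_j < p - 1 and applying
    Cramer's rule shows that the minors of the Jacobian matrix kill f^b eta^p
    ([jacobian_minor_mul]). If J kills it too, then it comes from a class of R of degree
    less than - D delta which is annihilated by an ideal generated in degree delta and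
    primary to the irrelevant ideal, and such a class is 0 ([residue_annihilator]). This
    is where the bound on p enters: descending from b = (p - 1, ..., p - 1), one finds
    f^b eta^p = 0 for all b, hence eta^p = 0 and eta = 0 ([frobenius_descent]).

    That a class of degree less than - D delta annihilated by such an ideal is 0 would
    follow from choosing D general elements of the ideal as parameters, but this
    requires an infinite field. Instead, a zigzag in the double complex formed by the
    Cech complex of R and the Koszul complex of all the minors is used ([zigzag]): the
    Cech complex is exact below degree D, the Koszul complex is exact wherever some
    variable is inverted, and the zigzag ends in R itself in negative degree.

    Everything takes place in the Koszul complexes of the powers x_0^e, ..., x_n^e over
    S, whose union over e is the Cech complex; congruences modulo J are kept explicit,
    so that no quotient ring occurs before the last part. *)

(** * Ideals generated by initial segments of a sequence *)

Section InitialIdeals.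
Variables (A : comPzRingType) (c : nat) (f : 'I_c -> A).
Implicit Types (G : A -> Prop) (a b : A) (l : 'I_c).

Lemma ideal_genN G a : ideal_gen G a -> ideal_gen G (- a).
Proof. by rewrite -mulN1r; apply: ideal_genM. Qed.

Lemma ideal_genB G a b : ideal_gen G a -> ideal_gen G b -> ideal_gen G (a - b).
Proof. by move=> Ga Gb; apply: ideal_genD => //; apply: ideal_genN. Qed.

Lemma ideal_gen_sum G (I : Type) (r : seq I) (P : pred I) (F : I -> A) :
  (forall i, P i -> ideal_gen G (F i)) -> ideal_gen G (\sum_(i <- r | P i) F i).
Proof.
move=> GF; elim/big_ind: _ => //; [exact: ideal_gen0|exact: ideal_genD].
Qed.

Lemma ideal_gen_sub G G' a :
  (forall g, G g -> ideal_gen G' g) -> ideal_gen G a -> ideal_gen G' a.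
Proof.
move=> GG' [s sG ->]; rewrite big_seq; apply: ideal_gen_sum => u us.
by apply/ideal_genM/GG'/sG.
Qed.

Lemma ideal_gen_exprp p G a : has_pchar A p ->
  ideal_gen G a -> ideal_gen G (a ^+ p).
Proof.
by move=> [/prime_gt0 p0 _] Ga; rewrite -(prednK p0) exprSr; apply: ideal_genM.
Qed.

Definition initial_ideal (j : nat) : A -> Prop :=
  ideal_gen (fun g => exists2 l : 'I_c, (l < j)%N & g = f l).

Lemma initial_ideal0 a : initial_ideal 0 a -> a = 0.
Proof.
move=> [s s0 ->]; rewrite big_seq big1 // => u /s0[l].
by rewrite ltn0.
Qed.

Lemma initial_ideal_mem l j : (l < j)%N -> initial_ideal j (f l).
Proof. by move=> lj; apply: ideal_gen_mem; exists l. Qed.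

Lemma initial_idealS j a : initial_ideal j a -> initial_ideal j.+1 a.
Proof.
apply: ideal_gen_sub => _ [l lj ->]; apply: initial_ideal_mem.
exact: ltnW.
Qed.

Lemma initial_ideal_split l a :
  initial_ideal l.+1 a -> exists w, initial_ideal l (a - f l * w).
Proof.
move=> [s]; elim: s a => [|u s IHs] a sG ->.
  by exists 0; rewrite big_nil mulr0 subrr; apply: ideal_gen0.
have [|w hw] := IHs (\sum_(v <- s) v.1 * v.2) _ erefl.
  by move=> v vs; apply: sG; rewrite inE vs orbT.
have [i + uE] := sG u (mem_head _ _); rewrite ltnS leq_eqVlt big_cons.
case/orP => [/eqP il|il].
  exists (w + u.1); rewrite uE (_ : i = l); last exact: val_inj.
  by have -> : u.1 * f l + \sum_(v <- s) v.1 * v.2 - f l * (w + u.1) =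
               \sum_(v <- s) v.1 * v.2 - f l * w by ring.
exists w; rewrite -addrA; apply: ideal_genD => //.
by rewrite uE; apply/ideal_genM/initial_ideal_mem.
Qed.

Lemma initial_ideal_join l a w :
  initial_ideal l (a - f l * w) -> initial_ideal l.+1 a.
Proof.
move=> /initial_idealS h; rewrite -(subrK (f l * w) a).
by apply: ideal_genD => //; rewrite mulrC; apply/ideal_genM/initial_ideal_mem.
Qed.

End InitialIdeals.

(** * Coefficients, truncations and division by powers of a variable *)

Section Coefficients.
Variables (k : fieldType) (n : nat).
Local Notation S := {mpoly k[n]}.
Implicit Types (u v g : S) (m a : 'X_{1..n}) (i j : 'I_n) (e : nat).

Lemma mcoeffXM a u m :
  ('X_[a] * u)@_m = if (a <= m)%MM then u@_(m - a)%MM else 0.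
Proof.
case: ifP => [am|/negP nam].
  by rewrite mulrC -{1}(submK am) addmC mcoeffMX; congr (_ @_ _).
rewrite mcoeffM big1 // => -[k1 k2] /= /eqP mE; rewrite mcoeffX.
case: eqP => [aE|]; last by rewrite mul0r.
case: nam; apply/mnm_lepP => i.
have := congr1 (fun m' : 'X_{1..n} => m' i) mE; rewrite mnmDE aE => h.
exact: leq_trans (leq_addr _ _) (eq_leq (esym h)).
Qed.

Lemma mpolyXjn j e : 'X_j ^+ e = 'X_[U_(j) *+ e] :> S.
Proof. by rewrite mpolyXn. Qed.

Lemma le_mnm1n j e m : (U_(j) *+ e <= m)%MM = (e <= m j)%N.
Proof.
apply/mnm_lepP/idP => [/(_ j)|em i]; rewrite mulmnE mnm1E ?eqxx ?mul1n //.
by case: eqP => [<-|]; rewrite ?mul1n // mul0n.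
Qed.

Lemma mcoeffXjnM j e u m :
  ('X_j ^+ e * u)@_m = if (e <= m j)%N then u@_(m - U_(j) *+ e)%MM else 0.
Proof. by rewrite mpolyXjn mcoeffXM le_mnm1n. Qed.

Definition mfilter (Q : pred 'X_{1..n}) u : S :=
  \sum_(m <- msupp u | Q m) u@_m *: 'X_[m].

Lemma mcoeff_filter (Q : pred 'X_{1..n}) u m :
  (mfilter Q u)@_m = if Q m then u@_m else 0.
Proof.
rewrite raddf_sum /=; under eq_bigr do rewrite mcoeffZ mcoeffX.
rewrite big_mkcond /=.
case: (boolP (m \in msupp u)) => mu; last first.
  rewrite (memN_msupp_eq0 mu) if_same big_seq big1 // => m' m'u.
  case: eqP => [mE|_]; last by rewrite mulr0 if_same.
  by rewrite -mE m'u in mu.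
rewrite (bigD1_seq m) //= eqxx mulr1 big1 ?addr0 // => m' /negPf->.
by rewrite mulr0 if_same.
Qed.

Fact mfilter_zmod_morphism Q : zmod_morphism (mfilter Q).
Proof.
move=> u v; apply/mpolyP => m; rewrite mcoeffB !mcoeff_filter mcoeffB.
by case: ifP => //; rewrite subrr.
Qed.
HB.instance Definition _ Q :=
  GRing.isZmodMorphism.Build S S (mfilter Q) (mfilter_zmod_morphism Q).

(** [degcut B T] keeps the degrees t with t + B < T; the inequality is stated
    without subtraction because T - B may be negative. *)
Definition degcut (B T : nat) : S -> S := mfilter (fun m => mdeg m + B < T)%N.
HB.instance Definition _ B T := GRing.Additive.on (degcut B T).

Lemma mcoeff_degcut B T u m :
  (degcut B T u)@_m = if (mdeg m + B < T)%N then u@_m else 0.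
Proof. exact: mcoeff_filter. Qed.

Lemma degcut_id B T u :
  (forall m, u@_m != 0 -> (mdeg m + B < T)%N) -> degcut B T u = u.
Proof.
move=> uB; apply/mpolyP => m; rewrite mcoeff_degcut.
by case: ifPn => //; have [->//|/uB->] := eqVneq u@_m 0.
Qed.

Lemma degcut_supp B T u m : degcut B T u = u -> u@_m != 0 -> (mdeg m + B < T)%N.
Proof. by move=> <-; rewrite mcoeff_degcut; case: ifP => //; rewrite eqxx. Qed.

Lemma degcut_homog s B T g u : g \is s.-homog ->
  degcut B T (g * u) = g * degcut (B + s) T u.
Proof.
move=> gs; apply/mpolyP => m; rewrite mcoeff_degcut.
have -> : (if (mdeg m + B < T)%N then (g * u)@_m else 0) =
    \sum_(i : 'X_{1..n < (mdeg m).+1, (mdeg m).+1} | m == (i.1 + i.2)%MM)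
      (if (mdeg m + B < T)%N then g@_i.1 * u@_i.2 else 0).
  case: ifP => _; first by rewrite mcoeffM.
  by rewrite big1.
rewrite mcoeffM; apply: eq_bigr => -[m1 m2] /= /eqP mE; rewrite mcoeff_degcut.
have [->|g1] := eqVneq g@_m1 0; first by rewrite !mul0r if_same.
have m1s : mdeg m1 = s by apply: (dhomogP _ _ _ gs); rewrite mcoeff_msupp.
have -> : (mdeg m + B = mdeg m2 + (B + s))%N.
  have := congr1 (@mdeg n) mE; rewrite mdegD m1s => h.
  by apply: etrans (congr1 (addn^~ B) h) _; rewrite addnAC addnC [(s + B)%N]addnC.
by case: ifP => // _; rewrite mulr0.
Qed.

Lemma degcutDD B T e u : degcut (B + e) (T + e) u = degcut B T u.
Proof. by apply/mpolyP => m; rewrite !mcoeff_degcut addnA ltn_add2r. Qed.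

Lemma homogXjn j e : 'X_j ^+ e \is [in k[n], e.-homog].
Proof. by rewrite mpolyXjn dhomogX; apply/eqP; rewrite /= mdegMn mdeg1 mul1n. Qed.

Lemma degcut_Xjn B T j e u :
  degcut B (T + e) ('X_j ^+ e * u) = 'X_j ^+ e * degcut B T u.
Proof. by rewrite (degcut_homog _ _ _ (homogXjn j e)) degcutDD. Qed.

(** Quotient of the Euclidean division by the monomial 'X_j ^+ e. *)
Definition divXn j e u : S :=
  \sum_(m <- msupp u | (e <= m j)%N) u@_m *: 'X_[m - U_(j) *+ e].

Lemma divXnE j e u : 'X_j ^+ e * divXn j e u = mfilter (fun m => e <= m j)%N u.
Proof.
rewrite mulr_sumr; apply: eq_bigr => m em.
rewrite -scalerAr mpolyXjn -mpolyXD; congr (_ *: 'X_[_]).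
by rewrite addmC submK // le_mnm1n.
Qed.

Lemma mcoeff_divXn j e u m : (divXn j e u)@_m = u@_(m + U_(j) *+ e)%MM.
Proof.
have := congr1 (mcoeff (m + U_(j) *+ e)%MM) (divXnE j e u).
have le_e : (e <= (m + U_(j) *+ e)%MM j)%N.
  by rewrite mnmDE mulmnE mnm1E eqxx mul1n leq_addl.
by rewrite mcoeffXjnM mcoeff_filter le_e addmK.
Qed.

Fact divXn_zmod_morphism j e : zmod_morphism (divXn j e).
Proof. by move=> u v; apply/mpolyP => m; rewrite !(mcoeff_divXn, mcoeffB). Qed.
HB.instance Definition _ j e :=
  GRing.isZmodMorphism.Build S S (divXn j e) (divXn_zmod_morphism j e).

Lemma divXnK j e u : divXn j e ('X_j ^+ e * u) = u.
Proof.
apply/mpolyP => m; rewrite mcoeff_divXn mcoeffXjnM addmK.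
by rewrite mnmDE mulmnE mnm1E eqxx mul1n leq_addl.
Qed.

Lemma divXnC j l e u : l != j ->
  divXn j e ('X_l ^+ e * u) = 'X_l ^+ e * divXn j e u.
Proof.
move=> lj; apply/mpolyP => m; rewrite mcoeff_divXn !mcoeffXjnM mcoeff_divXn.
rewrite mnmDE mulmnE mnm1E eq_sym (negPf lj) mul0n addn0.
case: ifP => // el; congr (_@_ _); apply/mnmP => i.
rewrite !(mnmDE, mnmBE, mulmnE, mnm1E).
case: (eqVneq l i) => [<-|_]; last by rewrite mul0n !subn0.
by rewrite eq_sym (negPf lj) mul0n !addn0.
Qed.

(** Membership in the ideal of the e-th powers of the variables. *)
Definition in_powers e u : Prop := forall m, u@_m != 0 -> exists j, (e <= m j)%N.

Lemma in_powers0 e : in_powers e 0.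
Proof. by move=> m; rewrite mcoeff0 eqxx. Qed.

Lemma in_powersD e u v : in_powers e u -> in_powers e v -> in_powers e (u + v).
Proof.
move=> ue ve m; rewrite mcoeffD; have [->|/ue//] := eqVneq u@_m 0.
by rewrite add0r => /ve.
Qed.

Lemma in_powersM e u v : in_powers e v -> in_powers e (u * v).
Proof.
move=> ve m; rewrite mcoeffM => uvm.
have /existsP[/= i /andP[/eqP mE h]] : [exists i :
    'X_{1..n < (mdeg m).+1, (mdeg m).+1}, (m == (i.1 + i.2)%MM)
      && (u@_i.1 * v@_i.2 != 0)].
  apply: contraNT uvm => /existsPn h; apply/eqP/big1 => i mE.
  by have := h i; rewrite mE negbK => /eqP.
have /ve[j jP] : v@_i.2 != 0 by apply: contraNneq h => ->; rewrite mulr0.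
exists j; apply: leq_trans jP _.
by have := congr1 (fun m' : 'X_{1..n} => m' j) mE; rewrite mnmDE => hj;
  apply: leq_trans (leq_addl _ _) (eq_leq (esym hj)).
Qed.

Lemma in_powers_sum e (I : Type) (r : seq I) (P : pred I) (F : I -> S) :
  (forall r0, P r0 -> in_powers e (F r0)) -> in_powers e (\sum_(i <- r | P i) F i).
Proof. by move=> h; elim/big_ind: _ => //; [exact: in_powers0|exact: in_powersD]. Qed.

Lemma in_powersXn e j : in_powers e ('X_j ^+ e).
Proof.
move=> m; rewrite mpolyXjn mcoeffX; case: (_ =P m) => [<- _|_]; last by rewrite eqxx.
by exists j; rewrite mulmnE mnm1E eqxx mul1n.
Qed.

(** The quotients by the ideals of e-th powers form a direct system, for
    multiplication by powers of the product of the variables, with injective maps. *)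
Lemma in_powers_raise e M u : in_powers (e + M) ((\prod_j 'X_j) ^+ M * u) ->
  in_powers e u.
Proof.
have -> : (\prod_j 'X_j) ^+ M = 'X_[(\sum_j U_(j)) *+ M] :> S.
  by rewrite mprodXE mpolyXn.
move=> uM m um; set a := (_ *+ M)%MM in uM.
have aE j : a j = M.
  rewrite mulmnE mnm_sumE (bigD1 j) //= mnm1E eqxx big1 ?mul1n // => i.
  by rewrite mnm1E => /negPf->.
have [|j] := uM (m + a)%MM; first by rewrite mcoeffXM lem_addl ?lepm_refl ?addmK.
by rewrite mnmDE aE leq_add2r; exists j.
Qed.

End Coefficients.

(** * The Koszul cochain complex of powers of the variables *)

Section Fractions.
Variables (A : comPzRingType) (u : A).

Lemma fracDe a b e : frac u a e + frac u b e = frac u (a + b) e.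
Proof. by rewrite fracD; apply/fracE; exists 0%N; rewrite exprD; ring. Qed.

Lemma frac0e e : frac u 0 e = 0.
Proof. by apply/frac_eq0; exists 0%N; rewrite mulr0. Qed.

Lemma frac_sum (I : Type) (r : seq I) (P : pred I) (F : I -> A) e :
  \sum_(i <- r | P i) frac u (F i) e = frac u (\sum_(i <- r | P i) F i) e.
Proof.
elim/big_rec2: _ => [|i a b _ ->]; first by rewrite frac0e.
by rewrite fracDe.
Qed.

Lemma frac_sign s a e : (-1) ^+ s * frac u a e = frac u ((-1) ^+ s * a) e.
Proof.
elim: s => [|s IHs]; first by rewrite !mul1r.
by rewrite !exprS -!mulrA IHs !mulN1r fracN.
Qed.

Lemma frac_raise a e M : frac u a e = frac u (u ^+ M * a) (e + M).
Proof. by apply/fracE; exists 0%N; rewrite exprD; ring. Qed.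

End Fractions.

Section Koszul.
Variables (k : fieldType) (n : nat).
Local Notation S := {mpoly k[n]}.
Local Notation cochain := {ffun {set 'I_n} -> S}.
Implicit Types (I : {set 'I_n}) (j l : 'I_n) (e i : nat) (z v w : cochain).

Definition ksign I j : S := (-1) ^+ #|[set l in I | (l < j)%N]|.

Definition kdiff e z : cochain :=
  [ffun I : {set 'I_n} => \sum_(j in I) ksign I j * ('X_j ^+ e * z (I :\ j))].

Fact kdiff_zmod_morphism e : zmod_morphism (kdiff e).
Proof.
move=> z v; apply/ffunP => I; rewrite !ffunE -sumrB; apply: eq_bigr => j _.
by rewrite !ffunE !mulrBr.
Qed.
HB.instance Definition _ e :=
  GRing.isZmodMorphism.Build cochain cochain (kdiff e) (kdiff_zmod_morphism e).

Definition kscale (a : S) z : cochain := [ffun I : {set 'I_n} => a * z I].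

Fact kscale_zmod_morphism a : zmod_morphism (kscale a).
Proof. by move=> z v; apply/ffunP => I; rewrite !ffunE mulrBr. Qed.
HB.instance Definition _ a :=
  GRing.isZmodMorphism.Build cochain cochain (kscale a) (kscale_zmod_morphism a).

Lemma kdiff_scale e a z : kdiff e (kscale a z) = kscale a (kdiff e z).
Proof.
apply/ffunP => I; rewrite !ffunE mulr_sumr; apply: eq_bigr => j _.
by rewrite !ffunE; ring.
Qed.

(** [kdeg i] is the degree i part of the complex and [kpred i] the degree i - 1
    part, which is 0 for i = 0. *)
Definition kdeg i z : Prop := forall I, #|I| <> i -> z I = 0.
Definition kpred i z : Prop := forall I, #|I|.+1 <> i -> z I = 0.

Lemma kpredS i z : kpred i.+1 z <-> kdeg i z.
Proof.
by split=> zi I h; apply: zi; [case=> hI|move=> hI]; apply: h; rewrite hI.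
Qed.

Lemma kdegB i z v : kdeg i z -> kdeg i v -> kdeg i (z - v).
Proof. by move=> zi vi I Ii; rewrite !ffunE zi // vi // subr0. Qed.

Lemma kpredD i z v : kpred i z -> kpred i v -> kpred i (z + v).
Proof. by move=> zi vi I Ii; rewrite !ffunE zi // vi // addr0. Qed.

Lemma kpred0 i : kpred i 0.
Proof. by move=> I _; rewrite ffunE. Qed.

Lemma kdeg_scale i a z : kdeg i z -> kdeg i (kscale a z).
Proof. by move=> zi I Ii; rewrite ffunE zi ?mulr0. Qed.

Lemma kdiff_pred e i z : kpred i z -> kdeg i (kdiff e z).
Proof.
move=> zi I Ii; rewrite ffunE big1 // => j jI; rewrite zi ?mulr0 //.
by rewrite [#|I|](cardsD1 j) jI in Ii.
Qed.

Lemma kdiff_deg e i z : kdeg i z -> kdeg i.+1 (kdiff e z).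
Proof. by move/kpredS; apply: kdiff_pred. Qed.

Lemma kdeg_large i z : (n < i)%N -> kdeg i z -> z = 0.
Proof.
move=> ni zi; apply/ffunP => I; rewrite zi ?ffunE // => Ii.
by have := max_card I; rewrite Ii card_ord leqNgt ni.
Qed.

(** A cochain at level e is the Cech cochain with the common denominators
    (\prod_(l in I) x_l) ^+ e. *)
Section Cech.
Variables (A : comPzRingType) (phi : {rmorphism S -> A}).
Local Notation x := (fun i : 'I_n => phi 'X_i).

Definition kfrac e z : cech x :=
  mkcech (fun I => frac (cprod x I) (phi (z I)) e).

Lemma cech_diff_kfrac e z : cech_diff (kfrac e z) = kfrac e (kdiff e z).
Proof.
apply: cechP => I; rewrite !cech_coordE ffunE rmorph_sum -frac_sum.
apply: eq_bigr => j jI; rewrite cech_coordE (loc_mapE (cprodD1 x jI)).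
by rewrite frac_sign !rmorphM rmorph_sign rmorphXn mulrA [_ * _ ^+ e]mulrC mulrA.
Qed.

End Cech.

Lemma kdiffK e z : kdiff e (kdiff e z) = 0.
Proof.
apply/ffunP => I; rewrite [RHS]ffunE.
have := congr1 (cech_coord I) (cech_diffK (kfrac idfun e z)).
rewrite !cech_diff_kfrac raddf0 cech_coordE => /frac_eq0[N /eqP].
rewrite mulf_eq0 expf_eq0 => /orP[/andP[_]|/eqP //].
rewrite /cprod prodf_seq_eq0 => /hasP[j _ /andP[_ /eqP]].
by move/mpolyP => /(_ U_(j)%MM)/eqP; rewrite mcoeffXU mcoeff0 eqxx oner_eq0.
Qed.

Lemma ksignK I j (a : S) : ksign I j * (ksign I j * a) = a.
Proof. by rewrite mulrA -expr2 sqrr_sign mul1r. Qed.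

Lemma divXn_ksign I j l e (a : S) :
  divXn j e (ksign I l * a) = ksign I l * divXn j e a.
Proof. exact: raddfMsign. Qed.

Lemma ksignU1 I j l : j \notin I ->
  #|[set i in j |: I | (i < l)%N]| = ((j < l) + #|[set i in I | (i < l)%N]|)%N.
Proof.
move=> jI; rewrite -!sum1dep_card !big_mkcondr big_setU1 //=.
Qed.

Lemma ksign_swap I j l : j \notin I -> l \in I ->
  ksign I j * ksign (j |: I) l = - (ksign I l * ksign (I :\ l) j).
Proof.
move=> jI lI; rewrite -mulN1r /ksign -!exprD -exprS; congr (_ ^+ _).
rewrite ksignU1 // -{1}(setD1K lI) ksignU1 ?inE ?eqxx //.
have jl : j != l by apply: contraNneq jI => ->.
have : ((l < j) + (j < l) = 1)%N by case: ltngtP jl => // /val_inj->; rewrite eqxx.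
by rewrite addnACA => ->; rewrite add1n [in RHS]addnC.
Qed.

Definition khomotopy j e z : cochain :=
  [ffun I : {set 'I_n} => if j \in I then 0 else ksign I j * divXn j e (z (j |: I))].

Definition kdivisible j e z : cochain :=
  [ffun I : {set 'I_n} => if j \in I then mfilter (fun m => e <= m j)%N (z I) else z I].

(** Division by 'X_j ^+ e contracts the complex onto the multidegrees in which
    the j-th exponent, taken relative to the denominator, is negative. *)
Lemma khomotopyE j e z :
  kdiff e (khomotopy j e z) + khomotopy j e (kdiff e z) = kdivisible j e z.
Proof.
apply/ffunP => I; rewrite [LHS]ffunE [kdiff e _ I]ffunE [khomotopy j e _ I]ffunE.
rewrite [RHS]ffunE; case: ifPn => jI.
  rewrite addr0 (bigD1 j) //= big1 ?addr0 => [|l /andP[lI lj]]; last first.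
    by rewrite ffunE !inE eq_sym lj jI mulr0 mulr0.
  rewrite ffunE !inE eqxx /= setD1K // -divXnE ['X_j ^+ e * (_ * _)]mulrCA mulrA.
  have -> : ksign (I :\ j) j = ksign I j.
    rewrite /ksign; congr (_ ^+ _); apply: eq_card => l; rewrite !inE.
    by case: eqP => // ->; rewrite ltnn !andbF.
  by rewrite -mulrA ksignK.
rewrite [kdiff e z _]ffunE big_setU1 //= raddfD /= mulrDr.
rewrite (setU1K jI) divXn_ksign divXnK addrCA -[RHS]addr0.
have -> : ksign (j |: I) j = ksign I j.
  by rewrite /ksign ksignU1 // ltnn.
rewrite ksignK; congr (_ + _).
rewrite raddf_sum /= mulr_sumr -big_split big1 //= => l lI.
have lj : l != j by apply: contraNneq jI => <-.
rewrite ffunE !inE (negPf jI) andbF divXn_ksign divXnC //.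
rewrite (_ : (j |: I) :\ l = j |: I :\ l); last first.
  by apply/setP => i; rewrite !inE; case: eqP => // ->; rewrite (negPf lj).
rewrite ![_ * (_ * ('X_l ^+ e * _))]mulrA.
rewrite ksign_swap // ; ring.
Qed.

(** In degree i < n every set I misses some j, and in degree n the hypothesis on
    [z setT] excludes the remaining multidegrees, so that the contractions for
    all j together kill the cocycle. *)
Lemma kexact e i z :
    kdeg i z -> kdiff e z = 0 -> in_powers e (z setT) ->
  exists2 v, kpred i v & z = kdiff e v.
Proof.
move=> zi dz zT.
have [v [z' [vi zE _ z'0]]] : exists v z', [/\ kpred i v, z = kdiff e v + z',
    kdiff e z' = 0 & forall I m, (z' I)@_m != 0 ->
      (z I)@_m != 0 /\ {in enum 'I_n, forall j, j \in I /\ (m j < e)%N}].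
  elim: (enum _) => [|j s [v [z' [vi zE dz' z'P]]]].
    by exists 0, z; split; rewrite ?raddf0 ?add0r //; apply: kpred0.
  exists (v + khomotopy j e z'), (z' - kdivisible j e z'); split.
  - apply: kpredD => // I Ii; rewrite ffunE; case: ifPn => // jI.
    suff -> : z' (j |: I) = 0 by rewrite raddf0 mulr0.
    apply/mpolyP => m; rewrite mcoeff0; apply/eqP/negP => /negP /z'P[].
    by rewrite zi ?mcoeff0 ?eqxx // cardsU1 jI.
  - rewrite raddfD /= -khomotopyE dz' [khomotopy j e 0](_ : _ = 0).
      by rewrite addr0 -addrA [kdiff e (khomotopy _ _ _) + _]addrC subrK.
    by apply/ffunP => I; rewrite !ffunE raddf0 mulr0 if_same.
  - by rewrite -khomotopyE dz' raddfB raddfD /= kdiffK dz' [khomotopy j e 0](_ : _ = 0)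
      ?raddf0 ?addr0 ?subr0 //; apply/ffunP => I; rewrite !ffunE raddf0 mulr0 if_same.
  move=> I m; rewrite !ffunE mcoeffB; case: ifPn => jI; last by rewrite subrr eqxx.
  rewrite mcoeff_filter; case: leqP => [_|mj]; first by rewrite subrr eqxx.
  rewrite subr0 => /z'P[zIm sI]; split=> // l; rewrite inE => /orP[/eqP->//|].
  exact: sI.
exists v => //; rewrite zE [z'](_ : _ = 0) ?addr0 //; apply/ffunP => I.
rewrite ffunE; apply/mpolyP => m; rewrite mcoeff0; apply/eqP/negP => /negP.
move/z'0 => [zIm mP].
have IT : I = setT by apply/setP => j; have [->] := mP j (mem_enum _ _); rewrite inE.
rewrite IT in zIm; have [j] := zT _ zIm.
by rewrite leqNgt; have [_ ->] := mP j (mem_enum _ _).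
Qed.

End Koszul.

(** * Cochains modulo a regular sequence *)

Section Regular.
Variables (k : fieldType) (n c : nat) (f : 'I_c -> {mpoly k[n]}).
Local Notation S := {mpoly k[n]}.
Local Notation cochain := {ffun {set 'I_n} -> S}.
Implicit Types (I : {set 'I_n}) (l : 'I_c) (e i j : nat) (z v w : cochain).
Implicit Types (g a eta : S).

Definition kin j z : Prop := forall I, initial_ideal f j (z I).

Lemma kinD j z w : kin j z -> kin j w -> kin j (z + w).
Proof. by move=> zj wj I; rewrite ffunE; apply: ideal_genD (zj I) (wj I). Qed.

Lemma kinB j z w : kin j z -> kin j w -> kin j (z - w).
Proof. by move=> zj wj I; rewrite !ffunE; apply: ideal_genB (zj I) (wj I). Qed.

Lemma kin_scale j a z : kin j z -> kin j (kscale a z).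
Proof. by move=> zj I; rewrite ffunE; apply: ideal_genM (zj I). Qed.

Lemma kin_scale_mem l j z : (l < j)%N -> kin j (kscale (f l) z).
Proof.
by move=> lj I; rewrite ffunE mulrC; apply/ideal_genM/initial_ideal_mem.
Qed.

Lemma kin_diff e j z : kin j z -> kin j (kdiff e z).
Proof.
move=> zj I; rewrite ffunE; apply: ideal_gen_sum => i _.
by do 2!apply: ideal_genM; apply: zj.
Qed.

Lemma kin_split l i z : kdeg i z -> kin l.+1 z ->
  exists2 w, kdeg i w & kin l (z - kscale (f l) w).
Proof.
move=> zi zl.
have /choice[w wP] : forall I, exists a,
    initial_ideal f l (z I - f l * a) /\ (#|I| <> i -> a = 0).
  move=> I; have [Ii|Ii] := eqVneq #|I| i.
    by have [a] := initial_ideal_split (zl I); exists a.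
  exists 0; split=> //; rewrite zi ?mulr0 ?subr0; first exact: ideal_gen0.
  exact/eqP.
exists [ffun I => w I] => I; first by rewrite ffunE; apply: (wP I).2.
by rewrite !ffunE; apply: (wP I).1.
Qed.

Lemma kin_join l z w : kin l (z - kscale (f l) w) -> kin l.+1 z.
Proof.
move=> h I; apply: (@initial_ideal_join _ _ _ _ _ (w I)).
by have := h I; rewrite !ffunE.
Qed.

(** For a cocycle modulo f_0, ..., f_(j-1), this is the vanishing of its class in the
    cohomology of the complex modulo these elements. *)
Definition kexactmod j e i z : Prop :=
  exists2 v, kpred i v & kin j (z - kdiff e v).

Hypothesis f_reg : forall l a, initial_ideal f l (f l * a) -> initial_ideal f l a.

Lemma kin_regular l z : kin l (kscale (f l) z) -> kin l z.
Proof. by move=> h I; apply: f_reg; have := h I; rewrite ffunE. Qed.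

(** One step of the long exact sequence of 0 -> A/J -> A/J -> A/(J + f l) -> 0
    for J generated by the predecessors of f l: if [w] lifts the coboundary of
    [z] through multiplication by [f l], both vanish or none does. *)
Lemma kexactmod_connecting_of_vanishing l e i z w :
    (forall u, kdeg i u -> kin l (kdiff e u) -> kexactmod l e i u) ->
    kdeg i z -> kin l (kdiff e z - kscale (f l) w) ->
  kexactmod l.+1 e i z <-> kexactmod l e i.+1 w.
Proof.
move=> van zi zw; split=> -[v vi hv].
  have dv : kdiff e (z - kdiff e v) = kdiff e z by rewrite raddfB /= kdiffK subr0.
  have [u ui hu] := kin_split (kdegB zi (kdiff_pred e vi)) hv.
  exists u; first exact/kpredS.
  apply: kin_regular; rewrite raddfB /= -kdiff_scale.
  rewrite (_ : _ - _ = kdiff e (z - kdiff e v - kscale (f l) u)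
                       - (kdiff e z - kscale (f l) w)).
    by apply: kinB => //; apply: kin_diff.
  by rewrite raddfB /= dv opprB [RHS]addrC addrA subrK.
have vi' : kdeg i v by apply/kpredS.
have [||u ui hu] := van (z - kscale (f l) v).
- by apply: kdegB => //; apply: kdeg_scale.
- rewrite raddfB /= kdiff_scale -[kdiff e z](subrK (kscale (f l) w)).
  rewrite -addrA -[kscale _ w - _]raddfB.
  by apply: kinD => //; apply: kin_scale.
exists u => //; apply: (@kin_join _ _ v).
by rewrite addrAC.
Qed.

(** Cohomology modulo a regular sequence of length j vanishes below degree n - j: by
    the long exact sequence, each further element costs one degree. *)
Lemma kexactmod_vanishing j e i z :
    (j <= c)%N -> (i + j < n)%N -> kdeg i z -> kin j (kdiff e z) ->
  kexactmod j e i z.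
Proof.
elim: j i z => [|j IHj] i z jc ijn zi dz.
  have [||v vi ->] := @kexact k n e i z zi.
  - by apply/ffunP => I; rewrite [RHS]ffunE; apply: initial_ideal0 (dz I).
  - rewrite zi; first exact: in_powers0.
    by rewrite cardsT card_ord => ni; rewrite -ni addn0 ltnn in ijn.
  by exists v => // I; rewrite subrr ffunE; apply: ideal_gen0.
pose l := Ordinal jc; rewrite -[j.+1]/l.+1 in dz *.
have [w wi hw] := kin_split (kdiff_deg e zi) dz.
have van u : kdeg i u -> kin l (kdiff e u) -> kexactmod l e i u.
  by apply: IHj; [apply: ltnW|rewrite /=; lia].
apply/(kexactmod_connecting_of_vanishing van zi hw)/IHj => //.
- exact: ltnW.
- by rewrite addSn -addnS.
apply: (@kin_regular l); rewrite -kdiff_scale.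
have := kin_diff e hw; rewrite raddfB /= kdiffK sub0r => h I.
by have := ideal_genN (h I); rewrite !ffunE opprK.
Qed.

Lemma kexactmod_connecting l e i z w :
    (i + l < n)%N -> kdeg i z -> kin l (kdiff e z - kscale (f l) w) ->
  kexactmod l.+1 e i z <-> kexactmod l e i.+1 w.
Proof.
move=> iln; apply: kexactmod_connecting_of_vanishing => u ui du.
exact/kexactmod_vanishing/du/ui/iln/ltnW/ltn_ord.
Qed.

(** [residue e j z eta]: the iterated connecting homomorphism
    H^(n-j)(A/(f_0, ..., f_(j-1))) -> ... -> H^n(A) = A/(x_0 ^+ e, ..., x_(n-1) ^+ e)
    sends the class of [z] to that of [eta]. *)
Inductive residue e : nat -> cochain -> S -> Prop :=
| residue0 z : kdeg n z -> residue e 0 z (z setT)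
| residueS l z w eta : kdeg (n - l.+1) z ->
    kin l (kdiff e z - kscale (f l) w) -> residue e l w eta ->
    residue e l.+1 z eta.

Lemma residue_deg e j z eta : residue e j z eta -> kdeg (n - j) z.
Proof. by case=> //; rewrite subn0. Qed.

(** The iterated connecting homomorphism is well defined and injective, since the
    cohomology just before the degrees it passes through vanishes. *)
Lemma residue_eq0 e j z eta : (j <= n)%N -> residue e j z eta ->
  kexactmod j e (n - j) z <-> in_powers e eta.
Proof.
move=> jn res; elim: res jn => [{}z zn _|l {}z w {}eta zi zw _ IH ln].
  rewrite subn0; split=> [[v vn zv]|zT].
    have -> : z setT = kdiff e v setT.
      by apply/eqP; rewrite -subr_eq0; have := initial_ideal0 (zv setT);
         rewrite !ffunE => ->.
    rewrite ffunE; apply: in_powers_sum => t _.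
    by apply: in_powersM; rewrite mulrC; apply/in_powersM/in_powersXn.
  have [|//|v vn ->] := @kexact k n e n z zn.
    exact/(kdeg_large (ltnSn n))/kdiff_deg.
  by exists v => // I; rewrite subrr ffunE; apply: ideal_gen0.
rewrite -(IH (ltnW ln)) -[(n - l)%N](subnSK ln).
by apply: kexactmod_connecting => //; lia.
Qed.

Lemma residue_scale e j g z eta :
  residue e j z eta -> residue e j (kscale g z) (g * eta).
Proof.
elim=> [{}z zn|l {}z w {}eta zi zw _ IH].
  have -> : g * z setT = kscale g z setT by rewrite ffunE.
  exact/residue0/kdeg_scale.
apply: residueS IH; first exact: kdeg_scale.
rewrite kdiff_scale (_ : kscale (f l) _ = kscale g (kscale (f l) w)).
  by rewrite -raddfB; apply: kin_scale.
by apply/ffunP => I; rewrite !ffunE mulrCA.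
Qed.

Definition kraise M z : cochain :=
  [ffun I : {set 'I_n} => (\prod_(i in I) 'X_i) ^+ M * z I].

Fact kraise_zmod_morphism M : zmod_morphism (kraise M).
Proof. by move=> z v; apply/ffunP => I; rewrite !ffunE mulrBr. Qed.
HB.instance Definition _ M :=
  GRing.isZmodMorphism.Build cochain cochain (kraise M) (kraise_zmod_morphism M).

Lemma kraise_scale M a z : kraise M (kscale a z) = kscale a (kraise M z).
Proof. by apply/ffunP => I; rewrite !ffunE mulrCA. Qed.

Lemma kdiff_raise e M z : kdiff (e + M) (kraise M z) = kraise M (kdiff e z).
Proof.
apply/ffunP => I; rewrite !ffunE mulr_sumr; apply: eq_bigr => j jI.
by rewrite ffunE [in RHS](big_setD1 j) //= exprD exprMn; ring.
Qed.

Lemma kdeg_raise i M z : kdeg i z -> kdeg i (kraise M z).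
Proof. by move=> zi I Ii; rewrite ffunE zi ?mulr0. Qed.

Lemma kpred_raise i M z : kpred i z -> kpred i (kraise M z).
Proof. by move=> zi I Ii; rewrite ffunE zi ?mulr0. Qed.

Lemma kin_raise j M z : kin j z -> kin j (kraise M z).
Proof. by move=> zj I; rewrite ffunE; apply: ideal_genM (zj I). Qed.

Lemma residue_raise e j M z eta :
  residue e j z eta -> residue (e + M) j (kraise M z) ((\prod_i 'X_i) ^+ M * eta).
Proof.
elim=> [{}z zn|l {}z w {}eta zi zw _ IH].
  have -> : (\prod_i 'X_i) ^+ M * z setT = kraise M z setT.
    rewrite ffunE; congr (_ ^+ _ * _).
    by apply: eq_bigl => i; rewrite inE.
  exact/residue0/kdeg_raise.
apply: residueS IH; first exact: kdeg_raise.
by rewrite kdiff_raise -kraise_scale -raddfB; apply: kin_raise.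
Qed.

Definition kfrob p z : cochain := [ffun I : {set 'I_n} => z I ^+ p].

Lemma kdiff_frob p e z : has_pchar S p ->
  kdiff (e * p) (kfrob p z) = kfrob p (kdiff e z).
Proof.
move=> pS; apply/ffunP => I; rewrite !ffunE pchar_expr_sum //.
apply: eq_bigr => j _; rewrite ffunE /ksign pchar_expr_sign //.
by rewrite exprMn exprM.
Qed.

Lemma kdeg_frob p i z : (0 < p)%N -> kdeg i z -> kdeg i (kfrob p z).
Proof. by move=> p0 zi I Ii; rewrite ffunE zi // expr0n eqn0Ngt p0. Qed.

(** If d z = f l * w modulo the predecessors of f l, then
    d (z ^+ p) = f l * (f l ^+ p.-1 * w ^+ p): each connecting homomorphism turns
    the Frobenius into f l ^+ p.-1 times the Frobenius. *)
Lemma residue_frob p e j z eta : has_pchar S p -> residue e j z eta ->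
  residue (e * p) j (kfrob p z)
    (\prod_(l < c | (l < j)%N) f l ^+ p.-1 * eta ^+ p).
Proof.
move=> pS; have p0 : (0 < p)%N by case: pS => /prime_gt0.
elim=> [{}z zn|l {}z w {}eta zi zw _ IH].
  have -> : z setT ^+ p = kfrob p z setT by rewrite ffunE.
  by rewrite big_pred0_eq mul1r; apply/residue0/kdeg_frob.
rewrite (bigD1 l) //= -mulrA.
rewrite (eq_bigl (fun i : 'I_c => (i < l)%N)) => [|i]; last first.
  by rewrite ltnS andbC ltn_neqAle.
apply: (residueS _ _ (residue_scale (f l ^+ p.-1) IH)); first exact: kdeg_frob.
rewrite kdiff_frob // => I; rewrite !ffunE mulrA -exprS prednK //.
rewrite -exprMn -pcharN_expr // -pcharD_expr //.
by apply: ideal_gen_exprp pS _; have := zw I; rewrite !ffunE.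
Qed.

(** The same truncation [degcut B] applied to numerators over denominators of
    degree e * #|I|, that is, to degrees in the Cech complex. *)
Definition kcut B e z : cochain :=
  [ffun I : {set 'I_n} => degcut B (e * #|I|) (z I)].

Fact kcut_zmod_morphism B e : zmod_morphism (kcut B e).
Proof. by move=> z v; apply/ffunP => I; rewrite !ffunE raddfB. Qed.
HB.instance Definition _ B e :=
  GRing.isZmodMorphism.Build cochain cochain (kcut B e) (kcut_zmod_morphism B e).

Lemma kdiff_cut B e z : kdiff e (kcut B e z) = kcut B e (kdiff e z).
Proof.
apply/ffunP => I; rewrite !ffunE raddf_sum; apply: eq_bigr => j jI.
rewrite ffunE [in RHS](cardsD1 j) jI add1n mulnSr /ksign raddfMsign /=.
by rewrite degcut_Xjn.
Qed.

Lemma kcut_scale s B e g z : g \is s.-homog ->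
  kcut B e (kscale g z) = kscale g (kcut (B + s) e z).
Proof. by move=> gs; apply/ffunP => I; rewrite !ffunE (degcut_homog _ _ _ gs). Qed.

Lemma kdeg_cut i B e z : kdeg i z -> kdeg i (kcut B e z).
Proof. by move=> zi I Ii; rewrite ffunE zi // raddf0. Qed.

Lemma degcut_idem B T u : degcut B T (degcut B T u) = degcut B T u :> S.
Proof.
apply: degcut_id => m; rewrite mcoeff_degcut.
by case: ifP => //; rewrite eqxx.
Qed.

Lemma kcut_idem B e z : kcut B e (kcut B e z) = kcut B e z.
Proof. by apply/ffunP => I; rewrite !ffunE degcut_idem. Qed.

Variable s : 'I_c -> nat.
Hypothesis f_homog : forall l, f l \is (s l).-homog.

Lemma kin_cut j B e z : kin j z -> kin j (kcut B e z).
Proof.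
move=> zj I; rewrite ffunE; have [t tP ->] := zj I; rewrite raddf_sum /= big_seq.
apply: ideal_gen_sum => u /tP[l lj ->]; rewrite mulrC (degcut_homog _ _ _ (f_homog l)).
by rewrite mulrC; apply/ideal_genM/initial_ideal_mem.
Qed.

Definition sdeg j : nat := \sum_(l < c | (l < j)%N) s l.

Lemma sdegS l : sdeg l.+1 = (s l + sdeg l)%N.
Proof.
rewrite /sdeg (bigD1 l) //=; congr (_ + _)%N; apply: eq_bigl => i.
by rewrite ltnS andbC ltn_neqAle.
Qed.

Lemma residue_exists j B e z :
    (j <= c)%N -> (j <= n)%N -> kdeg (n - j) z -> kin j (kdiff e z) ->
    kcut B e z = z ->
  exists2 eta, residue e j z eta & degcut (B + sdeg j) (e * n) eta = eta.
Proof.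
elim: j B z => [|j IHj] B z jc jn zi dz zB.
  rewrite subn0 in zi; exists (z setT); first exact: residue0.
  rewrite /sdeg big_pred0_eq addn0 -[in RHS]zB ffunE cardsT card_ord.
  by [].
pose l := Ordinal jc; rewrite -[j.+1]/l.+1 in zi dz *.
have [w0 wi0 hw0] := kin_split (kdiff_deg e zi) dz.
pose w := kcut (B + s l) e w0.
have hw : kin l (kdiff e z - kscale (f l) w).
  rewrite -zB kdiff_cut -(kcut_scale _ _ _ (f_homog l)) -raddfB /=.
  exact: kin_cut.
have dw : kin l (kdiff e w).
  apply: kin_regular; rewrite -kdiff_scale.
  have := kin_diff e hw; rewrite raddfB /= kdiffK sub0r => h I.
  by have := ideal_genN (h I); rewrite !ffunE opprK.
have [| | |eta res etaB] := IHj (B + s l)%N w _ _ _ dw (kcut_idem _ _ _).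
- exact: ltnW.
- exact: ltnW.
- by rewrite -(subnSK jn); apply: kdeg_cut.
exists eta; first exact: (residueS zi hw res).
by rewrite sdegS addnA.
Qed.

(** The image of the iterated connecting homomorphism is the annihilator of the
    sequence: if [w] is the lift obtained from the predecessors of f l, injectivity
    makes f l * w a coboundary modulo these predecessors, and the cochain it is the
    coboundary of lifts [eta] one step further. The total degree of the f l is the shift
    in degree. *)
Lemma residue_lift j B e eta :
    (j <= c)%N -> (j <= n)%N ->
    (forall l, (l < j)%N -> in_powers e (f l * eta)) ->
    degcut (B + sdeg j) (e * n) eta = eta ->
  exists z, [/\ residue e j z eta, kin j (kdiff e z) & kcut B e z = z].
Proof.
elim: j B => [|j IHj] B jc jn ann etaB.
  pose z : cochain := [ffun I => if I == setT then eta else 0].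
  have zT : z setT = eta by rewrite ffunE eqxx.
  have zn : kdeg n z.
    by move=> I In; rewrite ffunE; case: eqP => // IT; rewrite IT cardsT card_ord in In.
  exists z; split; first by rewrite -zT; apply: residue0.
    move=> I; rewrite (kdeg_large (ltnSn n) (kdiff_deg e zn)) ffunE.
    exact: ideal_gen0.
  apply/ffunP => I; rewrite !ffunE; case: eqP => [->|]; last by rewrite raddf0.
  by rewrite cardsT card_ord -[in LHS](addn0 B) -[RHS]etaB /sdeg big_pred0_eq.
pose l := Ordinal jc; rewrite -[j.+1]/l.+1 in ann etaB *.
have [| | | |w [res dw wB]] := IHj (B + s l)%N; [exact: ltnW|exact: ltnW| | |].
- by move=> i ij; apply: ann; apply: ltnW.
- by rewrite -addnA -sdegS.
have /(residue_eq0 (ltnW jn) (residue_scale (f l) res))[v vi hv] :=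
  ann l (ltnSn _).
have zi : kdeg (n - l.+1) (kcut B e v).
  by apply/kdeg_cut/kpredS; rewrite subnSK.
have zw : kin l (kdiff e (kcut B e v) - kscale (f l) w).
  rewrite -wB -(kcut_scale _ _ _ (f_homog l)) kdiff_cut -raddfB /=.
  apply: kin_cut => I; have := ideal_genN (hv I).
  by rewrite !ffunE opprB.
exists (kcut B e v); split; [exact: (residueS zi zw res)| |exact: kcut_idem].
exact: (kin_join zw).
Qed.

End Regular.

(** * Classes annihilated by an ideal of finite colength *)

Section Annihilator.
Variables (k : fieldType) (n c : nat) (f : 'I_c -> {mpoly k[n]}).
Local Notation S := {mpoly k[n]}.
Local Notation cochain := {ffun {set 'I_n} -> S}.
Variables (Omega : Type) (g : Omega -> S).
Local Notation family := (seq Omega -> cochain).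
Implicit Types (I : {set 'I_n}) (l : 'I_c) (e i j : nat) (z : cochain).
Implicit Types (w v : family) (a : Omega) (sigma : seq Omega).

(** The Koszul differential of the elements [g a], on cochains indexed by
    arbitrary sequences instead of alternating ones: sequences need no order on
    the index type, and the differential becomes a recursion on the sequence. *)
Fixpoint fdelta w sigma : cochain :=
  if sigma is a :: tau then
    kscale (g a) (w tau) - fdelta (fun rho => w (a :: rho)) tau
  else 0.

Lemma eq_fdelta w v sigma : w =1 v -> fdelta w sigma = fdelta v sigma.
Proof. by move=> /funext ->. Qed.

Lemma fdelta_morph (phi psi : {additive cochain -> cochain}) w sigma :
    (forall a z, phi (kscale (g a) z) = kscale (g a) (psi z)) ->
  phi (fdelta w sigma) = fdelta (fun tau => psi (w tau)) sigma.
Proof.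
move=> phig; elim: sigma w => [|a tau IHs] w /=; first by rewrite raddf0.
by rewrite raddfB phig IHs.
Qed.

Lemma fdeltaB w v sigma :
  fdelta (fun tau => w tau - v tau) sigma = fdelta w sigma - fdelta v sigma.
Proof.
elim: sigma w v => [|a tau IHs] w v /=; first by rewrite subrr.
by rewrite IHs raddfB /= !opprB addrACA [RHS]addrACA [X in _ = _ + X]addrC.
Qed.

Lemma fdelta0 sigma : fdelta (fun=> 0) sigma = 0.
Proof. by elim: sigma => [|a tau IHs] //=; rewrite IHs raddf0 subrr. Qed.

Lemma fdeltaK w sigma : fdelta (fdelta w) sigma = 0.
Proof.
elim: sigma w => [|a tau IHs] w //=.
rewrite fdeltaB IHs subr0.
rewrite (fdelta_morph (phi := kscale (g a)) (psi := kscale (g a))) ?subrr //.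
by move=> b z; apply/ffunP => I; rewrite !ffunE mulrCA.
Qed.

Lemma kin_fdelta j w sigma : (forall tau, kin f j (w tau)) -> kin f j (fdelta w sigma).
Proof.
elim: sigma w => [|a tau IHs] w wj /=.
  by move=> I; rewrite ffunE; apply: ideal_gen0.
by apply: kinB; [apply: kin_scale|apply: IHs].
Qed.

Lemma kdeg_fdelta i w sigma : (forall tau, kdeg i (w tau)) -> kdeg i (fdelta w sigma).
Proof.
elim: sigma w => [|a tau IHs] w wi /=; first by move=> I; rewrite ffunE.
by apply: kdegB; [apply: kdeg_scale|apply: IHs].
Qed.

Definition fcontract (t : {set 'I_n} -> seq (S * Omega)) w : family :=
  fun sigma => [ffun I : {set 'I_n} => \sum_(u <- t I) u.1 * w (u.2 :: sigma) I].

Lemma fcontract_coord t w sigma I :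
  fcontract t w sigma I = \sum_(u <- t I) u.1 * w (u.2 :: sigma) I.
Proof. exact: ffunE. Qed.

Lemma fdelta_lincomb t (W : S * Omega -> family) sigma I :
  fdelta (fun rho => [ffun I : {set 'I_n} => \sum_(u <- t I) u.1 * W u rho I]) sigma I =
  \sum_(u <- t I) u.1 * fdelta (W u) sigma I.
Proof.
elim: sigma W => [|a tau IHs] W /=.
  by rewrite ffunE big1 // => u _; rewrite mulr0.
rewrite !ffunE (IHs (fun u rho => W u (a :: rho))) mulr_sumr -sumrB.
by apply: eq_bigr => u _; rewrite !ffunE; ring.
Qed.

(** Contraction with coefficients h of 1 = \sum h * g is a contracting homotopy. *)
Lemma fcontractE t w sigma I :
  fdelta (fcontract t w) sigma I + fcontract t (fdelta w) sigma I =
  (\sum_(u <- t I) u.1 * g u.2) * w sigma I.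
Proof.
rewrite (fdelta_lincomb t (fun u rho => w (u.2 :: rho))).
rewrite fcontract_coord -big_split mulr_suml.
by apply: eq_bigr => u _; rewrite /= !ffunE; ring.
Qed.

Hypothesis f_reg : forall l (r : S), initial_ideal f l (f l * r) -> initial_ideal f l r.
Variable s : 'I_c -> nat.
Hypothesis f_homog : forall l, f l \is (s l).-homog.
Variable delta : nat.
Hypothesis g_homog : forall a, g a \is delta.-homog.

(** The elements [g a] generate, modulo the sequence f, an ideal that contains a
    power of the irrelevant ideal. *)
Hypothesis g_cover : exists M, forall I, I != set0 ->
  exists t : seq (S * Omega),
    initial_ideal f c ((\prod_(i in I) 'X_i) ^+ M - \sum_(u <- t) u.1 * g u.2).

(** Where some variable is inverted, the coefficients given by [g_cover] provide a
    contraction. In degree i > 0 every nonzero coordinate is of this kind. *)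
Lemma fdelta_exact i w : (0 < i)%N -> (forall sigma, kdeg i (w sigma)) ->
    (forall sigma, kin f c (fdelta w sigma)) ->
  exists M (v : family), (forall sigma, kdeg i (v sigma)) /\
    forall sigma, kin f c (kraise M (w sigma) - fdelta v sigma).
Proof.
move=> i0 wi dw; have [M cover] := g_cover.
have /choice[t tP] : forall I, exists t : seq (S * Omega), I != set0 ->
    initial_ideal f c ((\prod_(i in I) 'X_i) ^+ M - \sum_(u <- t) u.1 * g u.2).
  move=> I; case: (boolP (I == set0)) => [_|/cover[t tI]]; first by exists [::].
  by exists t.
have vi sigma : kdeg i (fcontract t w sigma).
  by move=> I Ii; rewrite fcontract_coord big1 // => u _; rewrite wi ?mulr0.
exists M, (fcontract t w); split=> // sigma I.
have [I0|In0] := eqVneq I set0.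
  have Ii : #|I| <> i by move=> Ii; move: i0; rewrite -Ii I0 cards0.
  rewrite !ffunE wi // (kdeg_fdelta sigma vi Ii) mulr0 subrr.
  exact: ideal_gen0.
rewrite !ffunE -[fdelta _ _ I](addrK (fcontract t (fdelta w) sigma I)).
rewrite fcontractE opprB addrCA -mulrBl; apply: ideal_genD.
  by rewrite fcontract_coord; apply: ideal_gen_sum => u _; apply/ideal_genM/dw.
by rewrite mulrC; apply/ideal_genM/tP.
Qed.

Lemma kraiseD M M' z : kraise M' (kraise M z) = kraise (M + M') z.
Proof. by apply/ffunP => I; rewrite !ffunE exprD; ring. Qed.

(** The zigzag in the double complex of [fdelta] and [kdiff]. A family of internal
    degree < - i * delta that is a [fdelta]-cocycle up to [kdiff]-coboundaries is
    pulled down along the rows, exact below degree n - c; it reaches row 0 in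
    negative degree, where there is nothing, and is then pushed back along the
    columns, exact up to raising denominators. *)
Lemma zigzag i e w v : (i + c <= n)%N ->
    (forall sigma, kdeg i (w sigma)) ->
    (forall sigma, kcut (i * delta) e (w sigma) = w sigma) ->
    (forall sigma, kpred i (v sigma)) ->
    (forall sigma, kin f c (fdelta w sigma - kdiff e (v sigma))) ->
  exists M (y x : family), [/\ forall sigma, kpred i (y sigma), forall sigma, kdeg i (x sigma) &
    forall sigma,
      kin f c (kraise M (w sigma) - kdiff (e + M) (y sigma) - fdelta x sigma)].
Proof.
elim: i e w v => [|i IHi] e w v icn wi wcut vi wv.
  exists 0%N, (fun=> 0), (fun=> 0); split=> [sigma|sigma|sigma I];
    [exact: kpred0|by move=> I; rewrite ffunE|].
  suff -> : w sigma = 0.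
    by rewrite fdelta0 !raddf0 !addr0 ffunE; apply: ideal_gen0.
  apply/ffunP => J; rewrite ffunE; have [J0|Jn0] := eqVneq J set0; last first.
    by apply: wi => /eqP; rewrite cards_eq0 (negPf Jn0).
  rewrite -wcut ffunE J0 cards0 muln0; apply/mpolyP => m.
  by rewrite mcoeff_degcut ltn0 mcoeff0.
pose v1 sigma := kcut (i * delta) e (v sigma).
have v1i sigma : kdeg i (v1 sigma) by apply/kdeg_cut/kpredS.
have wv1 sigma : kin f c (fdelta w sigma - kdiff e (v1 sigma)).
  rewrite (_ : fdelta w sigma = kcut (i * delta) e (fdelta w sigma)).
    by rewrite kdiff_cut -raddfB; apply/(kin_cut f_homog)/wv.
  rewrite (fdelta_morph (phi := kcut (i * delta) e)
             (psi := kcut (i * delta + delta) e)) => [|a z].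
    by apply: eq_fdelta => tau; rewrite [(i * delta + delta)%N]addnC -mulSn [RHS]wcut.
  exact: kcut_scale.
have fdd e' u sigma : kdiff e' (fdelta u sigma) = fdelta (fun tau => kdiff e' (u tau)) sigma.
  by apply: (fdelta_morph (phi := kdiff e') (psi := kdiff e')) => a z; apply: kdiff_scale.
have fdr M u sigma : kraise M (fdelta u sigma) = fdelta (fun tau => kraise M (u tau)) sigma.
  by apply: (fdelta_morph (phi := kraise M) (psi := kraise M)) => a z; apply: kraise_scale.
have dv1 sigma : kin f c (kdiff e (fdelta v1 sigma)).
  have := kin_fdelta sigma wv1.
  rewrite fdeltaB fdeltaK sub0r fdd => h I.
  by have := ideal_genN (h I); rewrite !ffunE opprK.
have /choice[v2 v2P] : forall sigma, exists u,
    kpred i u /\ kin f c (fdelta v1 sigma - kdiff e u).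
  move=> sigma; have [|u ui hu] := kexactmod_vanishing f_reg (leqnn c) _
    (kdeg_fdelta sigma v1i) (dv1 sigma); first by rewrite addSn in icn.
  by exists u.
have [|||||M [y [z [yi zi yz]]]] := IHi e v1 v2.
- by apply: leq_trans icn; rewrite addSn.
- exact: v1i.
- by move=> sigma; apply: kcut_idem.
- by move=> sigma; have [] := v2P sigma.
- by move=> sigma; have [] := v2P sigma.
pose r sigma := kraise M (w sigma) - kdiff (e + M) (z sigma).
have ri sigma : kdeg i.+1 (r sigma).
  by apply: kdegB; [apply: kdeg_raise|apply: kdiff_deg].
have dr sigma : kin f c (fdelta r sigma).
  rewrite fdeltaB -fdr -fdd.
  have h1 := kin_raise M (wv1 sigma).
  have h2 := kin_diff (e + M) (yz sigma).
  rewrite !raddfB /= kdiffK subr0 kdiff_raise in h2; rewrite raddfB /= in h1.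
  by have := kinD h1 h2; rewrite addrA subrK.
have [M' [z' [z'i rz']]] := fdelta_exact (ltn0Sn i) ri dr.
exists (M + M')%N, (fun sigma => kraise M' (z sigma)), z'; split=> // sigma.
  by apply/kpredS/kdeg_raise.
have := rz' sigma; rewrite raddfB /= kraiseD -kdiff_raise addnA.
by [].
Qed.

(** The polynomial [eta] stands for a class of degree less than - (n - c) * delta modulo
    the sequence f. The zigzag applies to the family that has this class at the empty
    sequence and 0 elsewhere. *)
Lemma residue_annihilator e eta : (c <= n)%N ->
    (forall l, in_powers e (f l * eta)) -> (forall a, in_powers e (g a * eta)) ->
    degcut ((n - c) * delta + sdeg s c) (e * n) eta = eta ->
  in_powers e eta.
Proof.
move=> cn feta geta etacut.
have [z [res dz zcut]] := residue_lift f_reg f_homog (leqnn c) cn (fun l _ => feta l) etacut.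
have /choice[v vP] : forall a, exists y, kpred (n - c) y /\ kin f c (kscale (g a) z - kdiff e y).
  move=> a.
  have [y yi hy] := (residue_eq0 f_reg cn (residue_scale (g a) res)).2 (geta a).
  by exists y.
pose w sigma : cochain := if sigma is [::] then z else 0.
pose v' sigma : cochain := if sigma is [:: a] then v a else 0.
have zi := residue_deg res.
have [|||||M [y [x [yi _ yx]]]] := @zigzag (n - c) e w v'.
- by rewrite subnK.
- by case=> [|? ?] //= I _; rewrite ffunE.
- by case=> [|? ?] //=; rewrite raddf0.
- by case=> [|a [|? ?]] /=; [apply: kpred0|apply: (vP a).1|apply: kpred0].
- case=> [|a [|b tau]] /=.
  + by rewrite raddf0 subr0 => I; rewrite ffunE; apply: ideal_gen0.
  + by rewrite subr0; apply: (vP a).2.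
  rewrite !raddf0 (eq_fdelta (v := fun=> 0)) // fdelta0 !(raddf0, oppr0, addr0) => I.
  by rewrite ffunE; apply: ideal_gen0.
apply: in_powers_raise (_ : in_powers (e + M) _).
apply/(residue_eq0 f_reg cn (residue_raise M res)).
by exists (y [::]) => //; have := yx [::]; rewrite /= subr0.
Qed.

End Annihilator.

(** * Derivations and the Jacobian ideal *)

Section Derivations.
Variables (k : fieldType) (n : nat).
Local Notation S := {mpoly k[n.+1]}.
Implicit Types (u v : S) (i : 'I_n.+1).

Lemma homog_prod_sum (I : Type) (r : seq I) (P : pred I) (F : I -> S) (d : I -> nat) :
  (forall j, P j -> F j \is (d j).-homog) ->
  \prod_(j <- r | P j) F j \is (\sum_(j <- r | P j) d j)%N.-homog.
Proof.
move=> Fd; elim/big_rec2: _ => [|j u e Pj ue]; first exact: dhomog1.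
exact: dhomogM (Fd j Pj) ue.
Qed.

Lemma mderiv_homog i d u : u \is d.-homog -> mderiv i u \is d.-1.-homog.
Proof.
move=> ud; apply/dhomogP => m; rewrite mcoeff_msupp mcoeff_deriv => um.
have : (m + U_(i))%MM \in msupp u.
  by rewrite mcoeff_msupp; apply: contraNneq um => ->; rewrite mul0rn.
by move/(dhomogP _ _ _ ud) => /= <-; rewrite mdegD mdeg1 addn1.
Qed.

Lemma mderiv_expr i u b : mderiv i (u ^+ b) = mderiv i u * (b%:R * u ^+ b.-1).
Proof.
elim: b => [|b IHb]; first by rewrite expr0 -mpolyC1 mderivC mul0r mulr0.
rewrite exprS mderivM IHb -[b.+1]add1n natrD.
by case: b {IHb} => [|b] /=; rewrite ?exprS; ring.
Qed.

Lemma mderiv_prod i (I : eqType) (r : seq I) (F : I -> S) : uniq r ->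
  mderiv i (\prod_(j <- r) F j) =
  \sum_(j <- r) mderiv i (F j) * \prod_(l <- r | l != j) F l.
Proof.
elim: r => [|a r IHr] /=; first by rewrite !big_nil -mpolyC1 mderivC.
move=> /andP[ar /IHr IH]; rewrite !big_cons mderivM IH eqxx /=; congr (_ * _ + _).
  rewrite big_seq [RHS]big_seq_cond; apply: eq_bigl => j.
  by case: (boolP (j \in r)) => //= jr; rewrite (contraNneq _ ar) // => <-.
rewrite mulr_sumr; apply: eq_big_seq => j jr.
rewrite big_cons ifT; first by ring.
by apply: contraNneq ar => ->.
Qed.

Variable p : nat.
Hypothesis kp : p \in [pchar k].

Let p_gt0 : (0 < p)%N. Proof. exact/prime_gt0/(pcharf_prime kp). Qed.

Lemma mpoly_exprp u : u ^+ p = \sum_(m <- msupp u) u@_m ^+ p *: 'X_[m *+ p].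
Proof.
rewrite {1}[u]mpolyE (pchar_expr_sum _ _ _ (mpoly_pchar n kp)).
by apply: eq_bigr => m _; rewrite exprZn mpolyXn.
Qed.

Lemma mcoeff_exprp u (m : 'X_{1..n.+1}) : (u ^+ p)@_(m *+ p) = u@_m ^+ p.
Proof.
rewrite mpoly_exprp raddf_sum /=.
have eqm (m' : 'X_{1..n.+1}) : ((m' *+ p)%MM == (m *+ p)%MM) = (m' == m).
  apply/eqP/eqP => [h|->//]; apply/mnmP => j.
  have := congr1 (fun x : 'X_{1..n.+1} => x j) h; rewrite !mulmnE.
  by move/eqP; rewrite eqn_pmul2r // => /eqP.
under eq_bigr do rewrite mcoeffZ mcoeffX eqm.
have [mu|mu] := boolP (m \in msupp u).
  rewrite (bigD1_seq m) //= eqxx mulr1 big1 ?addr0 // => m' /negPf->.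
  by rewrite mulr0.
rewrite (memN_msupp_eq0 mu) expr0n eqn0Ngt p_gt0 big_seq big1 // => m' m'u.
by case: eqP => [mE|_]; [rewrite -mE m'u in mu|rewrite mulr0].
Qed.

Lemma mcoeff_exprp_neq0 u m : (u ^+ p)@_m != 0 ->
  exists2 m', m = (m' *+ p)%MM & u@_m' != 0.
Proof.
rewrite mpoly_exprp raddf_sum /= => um.
have /hasP[m' m'u /andP[/eqP mE _]] :
    has (fun m' => ((m' *+ p)%MM == m) && (u@_m' != 0)) (msupp u).
  apply: contraNT um => /hasPn um; apply/eqP; rewrite big_seq big1 // => m' m'u.
  have := um m' m'u; rewrite mcoeffZ mcoeffX -mcoeff_msupp m'u andbT => /negPf->.
  by rewrite mulr0.
by exists m'; rewrite ?mE // -mcoeff_msupp.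
Qed.

(** The Frobenius of the polynomial ring is injective on top local cohomology, because
    membership in the ideal of e-th powers can be read off the monomials. *)
Lemma in_powers_exprp e u : in_powers (e * p) (u ^+ p) <-> in_powers e u.
Proof.
split=> ue m.
  move=> um; have /ue[j] : (u ^+ p)@_(m *+ p) != 0.
    by rewrite mcoeff_exprp expf_neq0.
  by rewrite mulmnE leq_pmul2r //; exists j.
move=> /mcoeff_exprp_neq0[m' -> /ue[j ej]].
by exists j; rewrite mulmnE leq_pmul2r.
Qed.

Lemma mderiv_exprp i u : mderiv i (u ^+ p) = 0.
Proof.
have [_ p0] := mpoly_pchar n kp.
by rewrite mderiv_expr p0 mul0r mulr0.
Qed.

(** Derivations preserve this ideal because 'X_i ^+ (e * p) has derivative 0. *)
Lemma in_powers_mderiv e i u : in_powers (e * p) u -> in_powers (e * p) (mderiv i u).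
Proof.
move=> ue m; rewrite mcoeff_deriv => um.
have [|j] := ue (m + U_(i))%MM; first by apply: contraNneq um => ->; rewrite mul0rn.
rewrite mnmDE mnm1E; case: (eqVneq i j) => [ij|_]; last by rewrite addn0; exists j.
rewrite addn1 leq_eqVlt => /orP[/eqP eE|]; last by exists j.
by move: um; rewrite ij -eE -mulr_natr natrM (pcharf0 kp) !mulr0 eqxx.
Qed.

Lemma degcut_exprp B B' T T' u : degcut B T u = u ->
    (forall t, (t + B < T)%N -> (t * p + B' < T')%N) ->
  degcut B' T' (u ^+ p) = u ^+ p.
Proof.
move=> uB BB'; apply: degcut_id => m /mcoeff_exprp_neq0[m' -> um'].
by rewrite mdegMn; apply/BB'/(degcut_supp uB).
Qed.

End Derivations.

Section Jacobian.
Variables (k : fieldType) (n c : nat) (f : 'I_c -> {mpoly k[n.+1]}).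
Local Notation S := {mpoly k[n.+1]}.
Implicit Types (l : 'I_c) (b : 'I_c -> nat) (r : 'I_c -> 'I_n.+1) (eta : S).

Definition jacobian_minor r : S := \det (rowsub r (jacobian_mx f)).

(** Cramer's rule: the adjugate of a square submatrix of the Jacobian matrix turns the
    relations into multiplication by its determinant. *)
Lemma jacobian_minor_mul e r (v : 'I_c -> S) :
    (forall i, in_powers e (\sum_l mderiv i (f l) * v l)) ->
  forall l, in_powers e (jacobian_minor r * v l).
Proof.
move=> Mv l; pose A := rowsub r (jacobian_mx f); pose V : 'cV[S]_c := \col_q v q.
have -> : jacobian_minor r * v l = (\adj A *m (A *m V)) l 0.
  by rewrite mulmxA mul_adj_mx mul_scalar_mx !mxE.
rewrite mxE; apply: in_powers_sum => q _; apply: in_powersM.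
rewrite mxE (eq_bigr (fun l => mderiv (r q) (f l) * v l)) // => l' _.
by rewrite !mxE.
Qed.

Variable s : 'I_c -> nat.
Hypothesis f_homog : forall l, f l \is (s l).-homog.
Hypothesis s_gt0 : forall l, (0 < s l)%N.

Lemma jacobian_minor_homog r :
  jacobian_minor r \is (\sum_(l < c) s l - c)%N.-homog.
Proof.
have -> : (\sum_(l < c) s l - c = \sum_(l < c) (s l).-1)%N.
  rewrite -[in X in (_ - X)%N](card_ord c) -sum1_card -sumnB //.
  by apply: eq_bigr => l _; rewrite subn1.
apply: rpred_sum => t _; rewrite rpredMsign.
have -> : (\sum_l (s l).-1 = \sum_l (s (t l)).-1)%N.
  exact: (reindex_inj (@perm_inj _ t)).
by apply: homog_prod_sum => l _; rewrite !mxE; apply: mderiv_homog.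
Qed.

Hypothesis jac_radical : forall i : 'I_n.+1,
  ideal_radical (ideal_add (jacobian_ideal f) (ideal_gen (range_of f))) 'X_i.

Lemma ideal_gen_range a : ideal_gen (range_of f) a -> initial_ideal f c a.
Proof. by apply: ideal_gen_sub => _ [l ->]; apply: initial_ideal_mem. Qed.

(** Indexing the minors by arbitrary selections of rows avoids a side condition on the
    index; compared with increasing selections, this only adds 0 and opposites. *)
Lemma jacobian_cover : exists M, forall I : {set 'I_n.+1}, I != set0 ->
  exists t : seq (S * ('I_c -> 'I_n.+1)),
    initial_ideal f c
      ((\prod_(i in I) 'X_i) ^+ M - \sum_(u <- t) u.1 * jacobian_minor u.2).
Proof.
have /choice[N NP] : forall i : 'I_n.+1, exists N,
    exists t : seq (S * ('I_c -> 'I_n.+1)),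
      initial_ideal f c ('X_i ^+ N - \sum_(u <- t) u.1 * jacobian_minor u.2).
  move=> i; have [N [a [b [[t tG ->] Jb XN]]]] := jac_radical i; exists N.
  rewrite {}XN.
  elim: t tG => [|u t IHt] tG.
    by exists [::]; rewrite !big_nil add0r subr0; apply: ideal_gen_range.
  have [|t' t'P] := IHt; first by move=> v vt; apply: tG; rewrite inE vt orbT.
  have [r [_ uE]] := tG u (mem_head _ _).
  exists ((u.1, r) :: t'); rewrite !big_cons /= uE -/(jacobian_minor r).
  by rewrite -[_ + _ + b]addrA opprD addrACA subrr add0r.
exists (\sum_i N i)%N => I /set0Pn[i iI]; have [t tP] := NP i.
pose a : S := 'X_i ^+ (\sum_(j | j != i) N j) *
  (\prod_(j in I :\ i) 'X_j) ^+ (\sum_i N i).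
exists [seq (a * u.1, u.2) | u <- t]; rewrite big_map /=.
rewrite (big_setD1 i) //= exprMn {1}(bigD1 i) //= exprD.
have -> : \sum_(u <- t) a * u.1 * jacobian_minor u.2 =
          a * \sum_(u <- t) u.1 * jacobian_minor u.2.
  by rewrite mulr_sumr; apply: eq_bigr => u _; rewrite mulrA.
rewrite -mulrA [X in X - _]mulrC -/a -mulrBr.
exact: ideal_genM.
Qed.

Variable p : nat.
Hypothesis kp : p \in [pchar k].
Hypothesis f_reg : forall l a, initial_ideal f l (f l * a) -> initial_ideal f l a.
Hypothesis cn : (c <= n.+1)%N.
Hypothesis p_ge : ((n.+1 - c) * (\sum_(l < c) s l - c) <= p)%N.

Definition fmon b : S := \prod_(l < c) f l ^+ b l.
Definition decr b l : 'I_c -> nat := fun q => (b q - (q == l))%N.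

Lemma fmon_decr b l : (0 < b l)%N -> fmon b = f l * fmon (decr b l).
Proof.
move=> bl; rewrite /fmon (bigD1 l) //= [in RHS](bigD1 l) //= /decr eqxx subn1.
rewrite mulrA -exprS prednK //; congr (_ * _); apply: eq_bigr => q /negPf ->.
by rewrite subn0.
Qed.

Lemma mderiv_fmon i b eta : mderiv i eta = 0 ->
  mderiv i (fmon b * eta) =
  \sum_l mderiv i (f l) * ((b l)%:R * (fmon (decr b l) * eta)).
Proof.
move=> deta; rewrite mderivM deta mulr0 addr0 /fmon.
rewrite (mderiv_prod i _ (index_enum_uniq _)) mulr_suml; apply: eq_bigr => l _.
rewrite mderiv_expr [in RHS](bigD1 l) //= /decr eqxx subn1 !mulrA.
congr (_ * _ * _); apply: eq_bigr => q /negPf ->.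
by rewrite subn0.
Qed.

(** Descending induction on the exponents b < p of the monomial f ^ b. All partial
    derivatives of f ^ (b + 1_j) * eta ^ p lie in the ideal of (e * p)-th powers,
    so the maximal minors of the Jacobian matrix multiply f ^ b * eta ^ p into
    it; the f l do so by induction, and the degree of f ^ b * eta ^ p is too small
    for a nonzero class annihilated by all of these. *)
Lemma frobenius_descent e eta :
    (forall l, in_powers e (f l * eta)) ->
    degcut (\sum_(l < c) s l) (e * n.+1) eta = eta ->
    in_powers (e * p) (\prod_(l < c) f l ^+ p.-1 * eta ^+ p) ->
  in_powers e eta.
Proof.
move=> feta etacut top; apply/(in_powers_exprp kp).
have p0 : (0 < p)%N by exact/prime_gt0/(pcharf_prime kp).
suff main t b : (forall l, (b l <= p.-1)%N) -> (\sum_l (p.-1 - b l) = t)%N ->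
    in_powers (e * p) (fmon b * eta ^+ p).
  have := main _ (fun=> 0%N) (fun=> leq0n _) erefl.
  by rewrite /fmon big1 ?mul1r // => l _; rewrite expr0.
elim: t b => [|t IHt] b bp bt.
  rewrite /fmon (eq_bigr (fun l => f l ^+ p.-1)) // => l _; congr (_ ^+ _).
  have : (p.-1 - b l == 0)%N.
    by have /eqP := bt; rewrite sum_nat_eq0 => /forallP/(_ l).
  by rewrite subn_eq0 => pb; apply/eqP; rewrite eqn_leq bp pb.
have [j bj] : exists j, (b j < p.-1)%N.
  apply/existsP; apply: contraPT bt => /existsPn h; rewrite big1 // => l _.
  by apply/eqP; rewrite subn_eq0 leqNgt h.
pose incr l q := (b q + (q == l))%N.
have decrK l : decr (incr l) l =1 b.
  by move=> q; rewrite /decr /incr addnK.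
have fmonK l : fmon (decr (incr l) l) = fmon b.
  by apply: eq_bigr => q _; rewrite decrK.
have incrP l : (b l < p.-1)%N -> in_powers (e * p) (fmon (incr l) * eta ^+ p).
  move=> bl; apply: IHt => [q|].
    rewrite /incr; case: eqP => [->|_]; first by rewrite addn1.
    by rewrite addn0.
  apply: succn_inj; rewrite -bt (bigD1 l) //= [in RHS](bigD1 l) //=.
  rewrite {1}/incr eqxx addn1 -addSn subnSK //; congr (_ + _)%N.
  by apply: eq_bigr => q /negPf ql; rewrite /incr ql addn0.
apply: (residue_annihilator f_reg f_homog jacobian_minor_homog jacobian_cover cn).
- move=> l; have [bl|bl] := ltnP (b l) p.-1.
    by have := incrP l bl; rewrite (@fmon_decr _ l) ?fmonK ?mulrA // /incr eqxx addn1.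
  have {bl} bl : b l = p.-1 by apply/eqP; rewrite eqn_leq bp bl.
  rewrite /fmon (bigD1 l) //= bl -!mulrA mulrA -exprS prednK //.
  rewrite mulrCA -exprMn; apply: in_powersM.
  exact/(in_powers_exprp kp).
- move=> r.
  have : in_powers (e * p) (jacobian_minor r *
      ((incr j j)%:R * (fmon (decr (incr j) j) * eta ^+ p))).
    apply: (jacobian_minor_mul (v := fun l =>
      (incr j l)%:R * (fmon (decr (incr j) l) * eta ^+ p))) => i.
    rewrite -mderiv_fmon ?(mderiv_exprp kp) //.
    exact/(in_powers_mderiv kp)/incrP.
  rewrite fmonK mulrCA => h m hm; apply: h.
  rewrite -mpolyC_nat mcoeffCM mulf_eq0 negb_or hm andbT.
  rewrite -(dvdn_pcharf kp) /incr eqxx addn1 gtnNdvd //.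
  by rewrite -(prednK p0) ltnS.
have bdeg : fmon b \is (\sum_(l < c) s l * b l)%N.-homog.
  by apply: homog_prod_sum => l _; apply: dhomogMn.
rewrite (degcut_homog _ _ _ bdeg); congr (_ * _).
apply: degcut_exprp etacut _ => // d dlt.
have sE : sdeg s c = \sum_(l < c) s l.
  by apply: eq_bigl => l; rewrite ltn_ord.
have sb : (\sum_(l < c) s l * b l < \sum_(l < c) s l * p.-1)%N.
  rewrite (bigD1 j) //= [in X in (_ < X)%N](bigD1 j) //= -addSn leq_add //.
    by rewrite ltn_pmul2l.
  by apply: leq_sum => l _; rewrite leq_mul2l bp orbT.
rewrite -big_distrl /= in sb; rewrite sE.
move: sb dlt p_ge p0; move: (\sum_(l < c) s l)%N (\sum_(l < c) s l * b l)%N => D Db.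
move: (_ * (D - c))%N => Q sb dlt pQ p0.
have : ((d + D).+1 * p <= e * n.+1 * p)%N by rewrite leq_mul2r dlt orbT.
have : (D * p = D * p.-1 + D)%N by rewrite -[in LHS](prednK p0) mulnSr.
rewrite mulSn mulnDl [(e * p * _)%N]mulnAC; lia.
Qed.

End Jacobian.

(** * Cech cohomology of the complete intersection *)

Section CechKoszul.
Variables (k : fieldType) (n c : nat) (f : 'I_c -> {mpoly k[n.+1]}).
Local Notation S := {mpoly k[n.+1]}.
Local Notation cochain := {ffun {set 'I_n.+1} -> S}.
Local Notation R := (quo (range_of f)).
Local Notation phi := (to_quo (range_of f)).
Implicit Types (I : {set 'I_n.+1}) (e M i : nat) (a b : cochain).

Definition ci_frac e a : cech (ci_var f) := kfrac phi e a.

Lemma ci_frac_coord e a I :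
  cech_coord I (ci_frac e a) = frac (cprod (ci_var f) I) (phi (a I)) e.
Proof. exact: cech_coordE. Qed.

Lemma ci_frac_diff e a : cech_diff (ci_frac e a) = ci_frac e (kdiff e a).
Proof. exact: cech_diff_kfrac. Qed.

Lemma cprod_ci_var I : cprod (ci_var f) I = phi (\prod_(i in I) 'X_i).
Proof. by rewrite rmorph_prod. Qed.

Lemma ci_frac_raise e M a : ci_frac (e + M) (kraise M a) = ci_frac e a.
Proof.
apply: cechP => I; rewrite !ci_frac_coord ffunE rmorphM rmorphXn /= -cprod_ci_var.
by rewrite -frac_raise.
Qed.

Fact ci_frac_zmod_morphism e : zmod_morphism (ci_frac e).
Proof.
move=> a b; apply: cechP => I; rewrite raddfB /= !ci_frac_coord !ffunE raddfB /=.
by rewrite fracN fracDe.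
Qed.
HB.instance Definition _ e :=
  GRing.isZmodMorphism.Build cochain (cech (ci_var f)) (ci_frac e)
    (ci_frac_zmod_morphism e).

Lemma initial_ideal_quo (u : S) : initial_ideal f c u <-> phi u = 0.
Proof.
rewrite -[0](rmorph0 phi) to_quoE subr0; split; last exact: ideal_gen_range.
by apply: ideal_gen_sub => _ [l _ ->]; apply: ideal_gen_mem; exists l.
Qed.

Lemma ci_frac_eq0 e a : ci_frac e a = 0 <-> exists M, kin f c (kraise M a).
Proof.
split=> [a0|[M aM]]; last first.
  rewrite -(ci_frac_raise e M); apply: cechP => I; rewrite ci_frac_coord raddf0.
  by rewrite (initial_ideal_quo _).1 ?frac0e.
have /choice[M MP] : forall I, exists M, phi ((\prod_(i in I) 'X_i) ^+ M * a I) = 0.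
  move=> I; have := congr1 (cech_coord I) a0.
  rewrite ci_frac_coord raddf0 => /frac_eq0[M].
  by rewrite cprod_ci_var -rmorphXn -rmorphM; exists M.
exists (\sum_I M I)%N => I; apply/initial_ideal_quo; rewrite ffunE (bigD1 I) //=.
by rewrite addnC exprD -mulrA rmorphM /= MP mulr0.
Qed.

(** Finitely many fractions have a common denominator; [Q] is any property of
    fractions that survives expansion. *)
Lemma ci_frac_surj (Q : {set 'I_n.+1} -> nat -> S -> Prop) (z : cech (ci_var f)) :
    (forall I, exists e u,
      cech_coord I z = frac (cprod (ci_var f) I) (phi u) e /\ Q I e u) ->
    (forall I e M u, Q I e u -> Q I (e + M)%N ((\prod_(i in I) 'X_i) ^+ M * u)) ->
  exists e a, z = ci_frac e a /\ forall I, Q I e (a I).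
Proof.
move=> zP Qr.
have /choice[d /choice[u uP]] := zP.
pose M I := (\sum_(J | J != I) d J)%N.
have dM I : (d I + M I = \sum_J d J)%N by rewrite [RHS](bigD1 I).
exists (\sum_J d J)%N, [ffun I : {set 'I_n.+1} => (\prod_(i in I) 'X_i) ^+ M I * u I]; split=> [|I].
  apply: cechP => I; rewrite ci_frac_coord ffunE rmorphM rmorphXn /= -cprod_ci_var.
  by rewrite -(dM I) -frac_raise; apply: (uP I).1.
by rewrite ffunE -(dM I); apply/Qr/(uP I).2.
Qed.

Lemma ci_frac_frob p e a :
  cech_frob p (ci_frac e a) = ci_frac (e * p) (kfrob p a).
Proof.
apply: cechP => I; rewrite cech_coordE !ci_frac_coord fracX.
by rewrite [in RHS]ffunE rmorphXn.
Qed.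

Lemma kcut_raise B e M a : kcut B (e + M) (kraise M a) = kraise M (kcut B e a).
Proof.
apply/ffunP => I; rewrite !ffunE mulnDl.
have xI : (\prod_(i in I) 'X_i) ^+ M \is [in k[n.+1], (M * #|I|).-homog].
  rewrite mulnC; apply: dhomogMn; rewrite -sum1_card.
  by apply: homog_prod_sum => i _; rewrite -(expr1 'X_i); apply: homogXjn.
by rewrite (degcut_homog _ _ _ xI) degcutDD.
Qed.

(** The cut-off at [0] says that every numerator has smaller degree than its
    denominator. Homogeneous components are not separated: a sum of classes of various
    negative degrees has a single such representative. *)
Definition negative_class i (h : local_coho f i) : Prop :=
  exists (z : cocycle (ci_var f) i) e a,
    [/\ h = coho_class z, cocycle_val z = ci_frac e a, kdeg i a & kcut 0 e a = a].

Lemma negative_class0 i : negative_class (0 : local_coho f i).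
Proof.
exists 0, 0%N, 0; split; rewrite ?raddf0 //.
by move=> I _; rewrite ffunE.
Qed.

Lemma negative_classB i (g h : local_coho f i) :
  negative_class g -> negative_class h -> negative_class (g - h).
Proof.
move=> [y [d [a [-> yE ai acut]]]] [z [e [b [-> zE bi bcut]]]].
exists (y - z), (d + e)%N, (kraise e a - kraise d b); split.
- by rewrite raddfB.
- rewrite raddfB /= ci_frac_raise addnC ci_frac_raise.
  by rewrite -yE -zE.
- by apply: kdegB; apply: kdeg_raise.
by rewrite raddfB /= kcut_raise [(d + e)%N]addnC kcut_raise acut bcut.
Qed.

Lemma negative_class_homog i (t : int) (h : local_coho f i) : t < 0 ->
  coho_homog (@ci_degree k n c f) t h -> negative_class h.
Proof.
move=> t0 [z zt hz].
have /asboolP[zi _] := cocycleP z.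
have [||e [a [zE aP]]] := @ci_frac_surj
    (fun I e u => (#|I| <> i -> u = 0) /\ degcut 0 (e * #|I|) u = u) (cocycle_val z).
- move=> I; have [Ii|/eqP Ii] := eqVneq #|I| i; last first.
    exists 0%N, 0; rewrite zi // raddf0 frac0e; split=> //; split=> //.
    exact: raddf0.
  have [->|[s [r [e [[u us ->] zE tE]]]]] := zt I.
    by exists 0%N, 0; rewrite raddf0 frac0e; split=> //; split=> //; apply: raddf0.
  exists e, u; split=> //; split=> //; apply: degcut_id => m um.
  have -> : mdeg m = s by apply: (dhomogP _ _ _ us); rewrite mcoeff_msupp.
  by move: t0; rewrite tE addn0; lia.
- move=> I e M u [ui ucut]; split=> [Ii|]; first by rewrite ui // mulr0.
  have := congr1 (fun a : cochain => a I)
    (kcut_raise 0 e M [ffun J => if J == I then u else 0]).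
  by rewrite !ffunE eqxx ucut.
exists z, e, a; split=> //; first by move=> I; apply: (aP I).1.
by apply/ffunP => I; rewrite ffunE (aP I).2.
Qed.

Lemma negative_class_lt i (h : local_coho f i) :
  local_coho_lt 0 h -> negative_class h.
Proof.
move=> [t tP ->]; rewrite big_seq; elim/big_rec: _ => [|g h' gt h'n].
  exact: negative_class0.
rewrite -[h']opprK; apply: negative_classB; last first.
  by rewrite -sub0r; apply: negative_classB => //; apply: negative_class0.
by have [d d0 dg] := tP g gt; apply: negative_class_homog dg.
Qed.

Lemma coho_class_eq0 i (z : cocycle (ci_var f) i) :
  coho_class z = 0 <-> exists w : cech (ci_var f),
    (forall I, #|I|.+1 <> i -> cech_coord I w = 0) /\ cocycle_val z = cech_diff w.
Proof.
rewrite -[0](raddf0 (@coho_class _ _ (ci_var f) i)) coho_classE subr0.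
by split=> [/asboolP|h]; last exact/asboolP.
Qed.

End CechKoszul.

Theorem theoremB (k : fieldType) (p : nat) (kp : p \in [pchar k])
    (kfin : finite_over_pth_powers k p)
    (n c : nat) (f : 'I_c -> {mpoly k[n.+1]}) (e : 'I_c -> nat)
    (e_gt0 : forall j : 'I_c, (0 < e j)%N)
    (f_homog : forall j : 'I_c, f j \is (e j).-homog)
    (f_reg : regular_sequence f)
    (f_jac : forall g : {mpoly k[n.+1]},
      ideal_radical (ideal_add (jacobian_ideal f) (ideal_gen (range_of f))) g <->
      irrelevant_ideal g)
    (p_ge : ((n.+1 - c) * (\sum_(j < c) e j - c) <= p)%N) :
  forall h1 h2 : local_coho f (n.+1 - c),
    local_coho_lt 0 h1 -> local_coho_lt 0 h2 ->
    local_coho_frob kp h1 = local_coho_frob kp h2 -> h1 = h2.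
Proof.
move=> h1 h2 /negative_class_lt h1n /negative_class_lt h2n frob_eq.
apply/eqP; rewrite -subr_eq0; apply/eqP.
have [z [d [a [hE zE ai acut]]]] := negative_classB h1n h2n.
rewrite hE; have [nc|cn] := leqP n.+1 c.
  (* Only the empty set of variables matters in degree 0, and a constant
     denominator leaves no room for a numerator of smaller degree. *)
  apply/coho_class_eq0; exists 0; split=> [I _|]; first exact: raddf0.
  rewrite zE raddf0 [a](_ : _ = 0) ?raddf0 //; apply/ffunP => I.
  rewrite -acut !ffunE; have [I0|In0] := eqVneq I set0; last first.
    rewrite ai ?raddf0 // => /eqP; rewrite (eqP (_ : n.+1 - c == 0)%N) //.
    by rewrite cards_eq0 (negPf In0).
  rewrite I0 cards0 muln0; apply/mpolyP => m.
  by rewrite mcoeff_degcut ltn0 mcoeff0.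
have {h1n h2n frob_eq hE} frob0 : coho_class
    (cocycle_frob (quo_pchar (range_of f) (mpoly_pchar n kp)) z) = 0.
  by rewrite -coho_frobE -hE raddfB /= [coho_frob _ _]frob_eq subrr.
have reg := f_reg.1; have cn' := ltnW cn.
(* The coboundary of a vanishes modulo f only after multiplication by a power of the
   variables, which is absorbed by a larger common denominator. *)
wlog da : d a zE ai acut / kin f c (kdiff d a).
  have /asboolP[_ dz] := cocycleP z.
  move: dz; rewrite zE ci_frac_diff => /ci_frac_eq0[M dM] wl.
  apply: (wl (d + M)%N (kraise M a)).
  - by rewrite ci_frac_raise.
  - exact: kdeg_raise.
  - by rewrite kcut_raise acut.
  by rewrite kdiff_raise.
have [eta res etacut] := residue_exists reg f_homog (leqnn c) cn' ai da acut.
have eta0 : in_powers d eta.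
  apply: (frobenius_descent f_homog e_gt0 _ kp reg cn' p_ge).
  - by move=> i; apply/f_jac; apply: ideal_gen_mem; exists i.
  - move=> l; apply/(residue_eq0 reg cn' (residue_scale (f l) res)).
    exists 0; first exact: kpred0.
    by rewrite raddf0 subr0; apply: kin_scale_mem.
  - move: etacut; rewrite add0n /sdeg (eq_bigl xpredT) // => l.
    exact: ltn_ord.
  have [w [wi wE]] := (coho_class_eq0 _).1 frob0.
  have [||d' [b [wb bP]]] := @ci_frac_surj _ _ _ f
      (fun I _ u => #|I|.+1 <> (n.+1 - c)%N -> u = 0) w.
  - move=> I; have [Ii|/eqP Ii] := eqVneq #|I|.+1 (n.+1 - c)%N.
      have [r [m ->]] := frac_surj (cech_coord I w); have [u ->] := to_quo_surj r.
      by exists m, u; split.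
    by exists 0%N, 0; rewrite wi // raddf0 frac0e.
  - by move=> I m M u uI Ii; rewrite uI // mulr0.
  (* The equation F(z) = d(w), written over the common denominator of exponent
     d * p + d'. *)
  have {wE wb w wi} : ci_frac f (d * p + d')
      (kraise d' (kfrob p a) - kraise (d * p) (kdiff d' b)) = 0.
    rewrite raddfB /= ci_frac_raise addnC ci_frac_raise -ci_frac_diff -wb -wE.
    by rewrite /= zE ci_frac_frob; apply: subrr.
  move=> /ci_frac_eq0[M hM].
  have resF := residue_raise (d' + M) (residue_frob (mpoly_pchar n kp) res).
  have := (residue_eq0 reg cn' resF).1.
  move=> /(_ _)/in_powers_raise; rewrite (eq_bigl xpredT); last first.
    by move=> l; rewrite ltn_ord.
  apply; exists (kraise (d * p + M) b); first exact/kpred_raise.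
  rewrite addnCA kdiff_raise -!kraiseD -raddfB.
  exact: hM.
have [v vi av] := (residue_eq0 reg cn' res).2 eta0.
apply/coho_class_eq0; exists (ci_frac f d v); split=> [I Ii|].
  by rewrite ci_frac_coord vi // raddf0 frac0e.
rewrite zE ci_frac_diff; apply/eqP; rewrite -subr_eq0 -raddfB; apply/eqP.
by apply/ci_frac_eq0; exists 0%N; apply: kin_raise.
Qed.
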